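(* Let $A$ be a Noetherian standard $\mathbb{N}$-graded algebra over an Artinian local ring $A_0$. Let $t$ be a positive integer, let $I_1,\ldots,I_t$ be homogeneous ideals of $A$, and let $M$ be a finitely generated $\mathbb{N}$-graded $A$-module. Then there exist two integers $k, k'$ such that \[ \mathrm{reg}(I_1^{n_1}\cdots I_t^{n_t} M) \le (n_1 + \cdots + n_t)\, k + k' \quad\text{for all } n_1,\ldots,n_t \in \mathbb{N}. \]
   Context: All rings are commutative with identity, and $\mathbb{N}$ is the set of non-negative integers. An $\mathbb{N}$-graded ring $A=\bigoplus_{i\in\mathbb{N}}A_i$ is standard if $A = A_0[A_1]$, i.e. $A$ is generated as an $A_0$-algebra by elements of degree one; being Noetherian, $A=A_0[x_1,\ldots,x_d]$ for some $x_1,\ldots,x_d\in A_1$. Let $A_+ = \langle x_1,\ldots,x_d\rangle$ be the ideal generated by the elements of positive degree. Castelnuovo-Mumford regularity: for a finitely generated $\mathbb{N}$-graded $A$-module $N$ and $i\ge 0$, let $H^i_{A_+}(N)$ be the $i$-th local cohomology module of $N$ with respect to $A_+$ (a graded $A$-module). Set $a_i(N) := \max\{\mu : H^i_{A_+}(N)_\mu \neq 0\}$ if $H^i_{A_+}(N)\ne 0$, and $a_i(N) := -\infty$ otherwise. Then $\mathrm{reg}(N) := \max\{a_i(N)+i : i\ge 0\}$ (so $\mathrm{reg}(0)=-\infty$). The module $I_1^{n_1}\cdots I_t^{n_t}M$ is a graded submodule of $M$ and is given the grading induced from $M$; by convention $I_j^0 = A$. *)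

(* Defs.v *)
From HB Require Import structures.
From mathcomp Require Import all_boot all_order all_algebra generic_quotient.
From mathcomp Require Import boolp classical_sets constructive_ereal zify.

Set Implicit Arguments.
Unset Strict Implicit.
Unset Printing Implicit Defensive.

Import Order.TTheory GRing.Theory Num.Theory.

Local Open Scope ring_scope.
Local Open Scope classical_set_scope.
Local Open Scope quotient_scope.

(* Submodules of M are the library's [submodClosed M]; the ideals of R are the
   submodules of R^o, the improper ideal R being allowed. *)
Notation ideal R := (submodClosed R^o).

Section Submodules.
Variables (R : comNzRingType) (M : lmodType R).

Definition span_pred (G : set M) : {pred M} := fun v =>
  `[< exists n (c : 'I_n -> R) (g : 'I_n -> M),
        (forall i, G (g i)) /\ v = \sum_(i < n) c i *: g i >].

Lemma span_pred_closed (G : set M) : submod_closed (span_pred G).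
Proof.
split.
  apply/asboolP; exists 0%N, (fun=> 0), (fun=> 0); split=> [[]//|].
  by rewrite big_ord0.
move=> a u v /asboolP[n [c [g [Gg ->]]]] /asboolP[m [d [h [Gh ->]]]].
apply/asboolP; exists (n + m)%N.
exists (fun i => match split i with inl j => a * c j | inr j => d j end).
exists (fun i => match split i with inl j => g j | inr j => h j end).
split=> [i|]; first by case: (split i).
rewrite big_split_ord /= scaler_sumr; congr (_ + _); apply: eq_bigr => i _.
  by rewrite (unsplitK (inl i)) scalerA.
by rewrite (unsplitK (inr i)).
Qed.

HB.instance Definition _ (G : set M) :=
  GRing.isSubmodClosed.Build R M (span_pred G) (span_pred_closed G).

Definition span (G : set M) : submodClosed M := span_pred G.

Definition fullsub : submodClosed M := span setT.

Definition finitely_generated (N : submodClosed M) :=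
  exists s : seq M, N =i span [set` s].

Definition smul (I : ideal R) (N : submodClosed M) : submodClosed M :=
  span [set v | exists a m, [/\ a \in I, m \in N & v = a *: m]].

End Submodules.

Arguments fullsub {R} M.

Definition ideal_pow (R : comNzRingType) (I : ideal R) (n : nat) : ideal R :=
  iter n (smul I) (fullsub R^o).

Record submodule_type (R : comNzRingType) (M : lmodType R)
  (N : submodClosed M) := Submodule
  { submodule_val : M; submodule_valP : submodule_val \in N }.

Section SubmoduleType.
Variables (R : comNzRingType) (M : lmodType R) (N : submodClosed M).
HB.instance Definition _ := [isSub for @submodule_val R M N].
HB.instance Definition _ := [Choice of submodule_type N by <:].
HB.instance Definition _ :=
  [SubChoice_isSubLmodule of submodule_type N by <:].
End SubmoduleType.

Section RingProperties.
Variable R : comNzRingType.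

Definition noetherian := forall I : ideal R, finitely_generated I.

Definition artinian := forall J : nat -> ideal R,
  (forall n, {subset J n.+1 <= J n}) ->
  exists n0, forall n, (n0 <= n)%N -> J n =i J n0.

Definition maximal_ideal (m : ideal R) :=
  1 \notin m /\
  forall J : ideal R, {subset m <= J} -> 1 \notin J -> J =i m.

Definition local_ring := exists m : ideal R,
  maximal_ideal m /\ forall m' : ideal R, maximal_ideal m' -> m' =i m.

End RingProperties.

(* V is the internal direct sum of the subgroups g i *)
Definition direct_decomposition (V : zmodType) (g : nat -> set V) :=
  [/\ forall i, g i 0 /\ (forall u v, g i u -> g i v -> g i (u - v)),
      forall v, exists n (c : nat -> V),
        (forall i, g i (c i)) /\ v = \sum_(i < n) c i
    & forall n (c : nat -> V), (forall i, g i (c i)) ->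
        \sum_(i < n) c i = 0 -> forall i, (i < n)%N -> c i = 0].

Record ring_grading (A : comNzRingType) := RingGrading {
  ring_piece :> nat -> set A;
  ring_piece_direct : direct_decomposition ring_piece;
  ring_piece1 : ring_piece 0%N 1;
  ring_pieceM : forall i j a b,
    ring_piece i a -> ring_piece j b -> ring_piece (i + j)%N (a * b)
}.

Record mod_grading (A : comNzRingType) (gA : ring_grading A) (M : lmodType A) :=
  ModGrading {
  mod_piece :> nat -> set M;
  mod_piece_direct : direct_decomposition mod_piece;
  mod_pieceZ : forall i j a m,
    gA i a -> mod_piece j m -> mod_piece (i + j)%N (a *: m)
}.

Section DegreeZero.
Variables (A : comNzRingType) (gA : ring_grading A).

Definition deg0_pred : {pred A} := fun a => `[< gA 0%N a >].

Lemma deg0_pred_closed : subring_closed deg0_pred.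
Proof.
have [g0 _ _] := ring_piece_direct gA; split.
- by apply/asboolP; exact: ring_piece1.
- by move=> a b /asboolP ha /asboolP hb; apply/asboolP/(g0 0%N).2.
- by move=> a b /asboolP ha /asboolP hb; apply/asboolP/(ring_pieceM ha hb).
Qed.

HB.instance Definition _ :=
  GRing.isSubringClosed.Build A deg0_pred deg0_pred_closed.

Record deg0 := Deg0 { deg0_val : A; deg0_valP : deg0_val \in deg0_pred }.
HB.instance Definition _ := [isSub for deg0_val].
HB.instance Definition _ := [Choice of deg0 by <:].
HB.instance Definition _ := [SubChoice_isSubComNzRing of deg0 by <:].

(* A = A_0[X] *)
Definition generates_over_deg0 (X : set A) :=
  forall S : {pred A}, subring_closed S ->
    (forall a, gA 0%N a -> a \in S) -> (forall a, X a -> a \in S) ->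
    forall a, a \in S.

Definition standard_grading := generates_over_deg0 (gA 1%N).

Definition homogeneous_ideal (I : ideal A) :=
  exists G : set A^o, (forall a, G a -> exists i, gA i a) /\ I =i span G.

End DegreeZero.

(* The localization N_f = N[f^-1] : pairs (m, k), standing for m / f^k, modulo
   (m, k) ~ (m', k')  iff  f^e (f^k' m - f^k m') = 0 for some e. *)
Section Localization.
Variables (A : comNzRingType) (N : lmodType A) (f : A).

Definition loc_eq (p q : N * nat) : bool :=
  `[< exists e, f ^+ (e + q.2) *: p.1 = f ^+ (e + p.2) *: q.1 >].

Lemma loc_eq_refl : reflexive loc_eq.
Proof. by move=> p; apply/asboolP; exists 0%N. Qed.

Lemma loc_eq_sym : symmetric loc_eq.
Proof. by move=> p q; apply/asboolP/asboolP => -[e he]; exists e. Qed.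

Lemma loc_eq_trans : transitive loc_eq.
Proof.
move=> [m k] [n l] [p q] /asboolP[/= e he] /asboolP[/= e' he'].
apply/asboolP; exists (e + e' + k)%N => /=.
rewrite (_ : _ + q = (e' + q) + (e + k))%N; last lia.
rewrite exprD -scalerA he scalerA mulrC -scalerA he' scalerA -exprD.
by congr (f ^+ _ *: _); lia.
Qed.

Canonical loc_eq_equiv := EquivRel loc_eq loc_eq_refl loc_eq_sym loc_eq_trans.

Definition loc := {eq_quot loc_eq}.
HB.instance Definition _ : EqQuotient _ loc_eq loc := EqQuotient.on loc.
HB.instance Definition _ := Choice.on loc.

Definition frac (m : N) (k : nat) : loc := \pi_loc (m, k).

Lemma fracP m k m' k' :
  frac m k = frac m' k' <->
  exists e, f ^+ (e + k') *: m = f ^+ (e + k) *: m'.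
Proof. by split=> [/eqmodP/asboolP//|h]; apply/eqmodP/asboolP. Qed.

Lemma frac_surj (u : loc) : exists m k, u = frac m k.
Proof. by exists (repr u).1, (repr u).2; rewrite /frac -surjective_pairing reprK. Qed.

Definition loc_add (u v : loc) : loc :=
  frac (f ^+ (repr v).2 *: (repr u).1 + f ^+ (repr u).2 *: (repr v).1)
       ((repr u).2 + (repr v).2).
Definition loc_opp (u : loc) : loc := frac (- (repr u).1) (repr u).2.

Lemma frac_repr m k :
  exists e, f ^+ (e + k) *: (repr (frac m k)).1
          = f ^+ (e + (repr (frac m k)).2) *: m.
Proof. by apply/fracP; rewrite /frac -surjective_pairing reprK. Qed.

Lemma loc_addE m k m' k' :
  loc_add (frac m k) (frac m' k') =
  frac (f ^+ k' *: m + f ^+ k *: m') (k + k').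
Proof.
have [e he] := frac_repr m k; have [e' he'] := frac_repr m' k'.
rewrite /loc_add; case: (repr (frac m k)) he => n l /= he.
case: (repr (frac m' k')) he' => n' l' /= he'.
apply/fracP; exists (e + e')%N; rewrite !scalerDr !scalerA -!exprD.
congr (_ + _).
  rewrite (_ : _ + l' = (e' + k' + l') + (e + k))%N; last lia.
  rewrite exprD -scalerA he scalerA -exprD; congr (f ^+ _ *: _).
  lia.
rewrite (_ : _ + l = (e + k + l) + (e' + k'))%N; last lia.
rewrite exprD -scalerA he' scalerA -exprD; congr (f ^+ _ *: _).
lia.
Qed.

Lemma loc_oppE m k : loc_opp (frac m k) = frac (- m) k.
Proof.
have [e he] := frac_repr m k; apply/fracP; exists e.
by rewrite !scalerN he.
Qed.

Lemma loc_addA : associative loc_add.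
Proof.
move=> u v w; have [m [k ->]] := frac_surj u; have [m' [k' ->]] := frac_surj v.
have [m'' [k'' ->]] := frac_surj w; rewrite !loc_addE !scalerDr !scalerA -!exprD.
by rewrite addrA addnA (addnC k'' k') (addnC k'' k).
Qed.

Lemma loc_addC : commutative loc_add.
Proof.
move=> u v; have [m [k ->]] := frac_surj u; have [m' [k' ->]] := frac_surj v.
by rewrite !loc_addE addrC addnC.
Qed.

Lemma loc_add0 : left_id (frac 0 0) loc_add.
Proof.
move=> u; have [m [k ->]] := frac_surj u.
by rewrite loc_addE scaler0 add0r expr0 scale1r.
Qed.

Lemma loc_addN : left_inverse (frac 0 0) loc_opp loc_add.
Proof.
move=> u; have [m [k ->]] := frac_surj u; rewrite loc_oppE loc_addE.
by rewrite scalerN addNr; apply/fracP; exists 0%N; rewrite !scaler0.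
Qed.

HB.instance Definition _ :=
  GRing.isZmodule.Build loc loc_addA loc_addC loc_add0 loc_addN.

End Localization.

Arguments frac {A N} f m k.

(* The map N_f -> N_(f g), m / f^k |-> g^k m / (f g)^k, with h = f g. *)
Definition loc_map (A : comNzRingType) (N : lmodType A) (f g h : A)
    (u : loc N f) : loc N h :=
  frac h (g ^+ (repr u).2 *: (repr u).1) (repr u).2.

Lemma loc_mapE (A : comNzRingType) (N : lmodType A) (f g h : A) (m : N) k :
  h = f * g -> loc_map g h (frac f m k) = frac h (g ^+ k *: m) k.
Proof.
move=> ->; have [e he] := frac_repr f m k; rewrite /loc_map.
case: (repr _) he => n l /= he; apply/fracP; exists e.
rewrite !exprMn !scalerA -!mulrA -!exprD ![f ^+ _ * _]mulrC -!scalerA he.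
by congr (g ^+ _ *: _); lia.
Qed.

Section Regularity.
Variables (A : comNzRingType) (d : nat) (x : 'I_d -> A).
Variables (N : lmodType A) (gN : nat -> set N).

Definition int_piece (mu : int) : set N :=
  if mu is Posz n then gN n else [set 0].

(* (N_f)_mu, for f homogeneous of degree e *)
Definition loc_piece (f : A) (e : nat) (mu : int) : set (loc N f) :=
  [set u | exists m k, int_piece (mu + (k * e)%N%:Z) m /\ u = frac f m k].

Definition xprod (S : {set 'I_d}) : A := \prod_(i in S) x i.

(* The Cech complex of N on x_1, ..., x_d, whose i-th term is the direct sum of
   the N_(x_S), |S| = i; a cochain is a family over all S, of any cardinal. *)
Definition cochain := forall S : {set 'I_d}, loc N (xprod S).

Definition cech_diff (c : cochain) : cochain := fun T =>
  \sum_(j in T) (loc_map (x j) (xprod T) (c (T :\ j)) *~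
                   (-1) ^+ #|[set l in T | (l < j)%N]|).

Definition cech (i : nat) (mu : int) : set cochain :=
  [set c : cochain | forall S : {set 'I_d},
     if #|S| == i then @loc_piece (xprod S) i mu (c S) else c S = 0].

Definition cocycles (i : nat) (mu : int) : set cochain :=
  [set c | cech i mu c /\ forall T, cech_diff c T = 0].

Definition coboundaries (i : nat) (mu : int) : set cochain :=
  [set c | exists b : cochain,
     (if i is j.+1 then cech j mu b else forall S, b S = 0) /\
     forall S, c S = cech_diff b S].

(* H^i(N)_mu <> 0, the cohomology being that of the Cech complex on x, that is,
   local cohomology with respect to the ideal generated by x. *)
Definition local_cohomology_neq0 (i : nat) (mu : int) :=
  exists2 c, cocycles i mu c & ~ coboundaries i mu c.

(* Suprema in Z U {-oo, +oo}; +oo occurs only for a set without upper bound. *)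
Definition a_inv (i : nat) : \bar int :=
  supremum -oo%E [set mu%:E%E | mu in local_cohomology_neq0 i].

Definition reg : \bar int :=
  supremum -oo%E [set (a_inv i + i%:Z%:E)%E | i in [set: nat]].

End Regularity.

Definition induced_piece (R : comNzRingType) (M : lmodType R)
    (gM : nat -> set M) (N : submodClosed M) (i : nat) :
    set (submodule_type N) :=
  [set v | gM i (val v)].

(* Main.v *)
Require Import Defs.
From HB Require Import structures.
From mathcomp Require Import all_boot all_order all_algebra.
From mathcomp Require Import boolp classical_sets constructive_ereal.
From mathcomp Require Import functions zify ring.

(* The modules I^n M are the pieces of the Rees module, which is generated by M
   over A under the operators "multiply by a generator a of I_j and shift n by
   e_j"; by Hilbert's basis argument its submodules satisfy the ascending chain
   condition. For graded families Q <= P of submodules of the I^n M one shows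
   that H^i(P_n/Q_n)_mu = 0 for mu >= K |n| + B, where K bounds the degrees of
   the generators, by descending induction on the number of x_j with
   x_j P <= Q. If all x_j kill P/Q, the chain of the families equal to P in
   degrees <= K |n| + m and to Q above is stationary, so that P and Q agree in
   degrees > K |n| + m for some m, whence the vanishing. Otherwise, the claim
   for (Q : x_j)/Q and P/(Q + x_j P), the kernel and the cokernel of x_j on P/Q,
   makes multiplication by x_j injective on H^i(P_n/Q_n) in large degrees; as
   every class is killed by a power of x_j, it vanishes there.
   Local cohomology is computed as a colimit of Koszul cohomologies, and the
   quotients P/Q are handled as pairs of submodules. *)

Import Order.TTheory GRing.Theory Num.Theory.
Local Open Scope ring_scope.

Set Implicit Arguments.
Unset Strict Implicit.
Unset Printing Implicit Defensive.

(** * Koszul cohomology of subquotients *)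

Section Koszul.
Variables (A : comNzRingType) (d : nat) (x : 'I_d -> A) (M : lmodType A).
Implicit Types (S T : {set 'I_d}) (j l : 'I_d) (m : {set 'I_d} -> M).

Definition cech_sign j T : A := (-1) ^+ #|[set l in T | (l < j)%N]|.

(** On numerators over the common denominators [xprod S ^+ s], this is the Cech differential. *)
Definition koszul_diff s m T : M :=
  \sum_(j in T) (cech_sign j T * x j ^+ s) *: m (T :\ j).

Lemma cech_signK j T : cech_sign j T * cech_sign j T = 1.
Proof. by rewrite -expr2 sqrr_sign. Qed.

(** Removing the smaller index lowers by one the number of elements below the larger one, while
    removing the larger index changes nothing for the smaller. *)
Lemma cech_sign_swap j l T : j \in T -> l \in T -> j != l ->
  cech_sign j T * cech_sign l (T :\ j) = - (cech_sign l T * cech_sign j (T :\ l)).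
Proof.
wlog lt_lj : j l / (l < j)%N => [IH jT lT neq|jT lT _].
  have [lt_lj|le_jl] := ltnP l j; first exact: IH.
  by rewrite (IH l j) ?opprK 1?eq_sym// ltn_neqAle le_jl andbT.
rewrite /cech_sign.
have -> : [set k in T :\ j | (k < l)%N] = [set k in T | (k < l)%N].
  apply/setP => k; rewrite !inE; case: eqVneq => //= ->.
  by rewrite ltnNge (ltnW lt_lj) /= andbF.
have -> : [set k in T :\ l | (k < j)%N] = [set k in T | (k < j)%N] :\ l.
  by apply/setP => k; rewrite !inE andbA.
rewrite [in LHS](cardsD1 l) inE lT lt_lj exprD expr1.
ring.
Qed.

(** A sum equal to its own opposite need not vanish, as 2 may be a zero divisor. Instead F j l = G j
    l - G l j, with G the part of F where l < j, and exchanging the order of summation cancels the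
    two halves. *)
Lemma sum_antisymmetric (T : {set 'I_d}) (F : 'I_d -> 'I_d -> M) :
  (forall j l, j \in T -> l \in T -> j != l -> F j l = - F l j) ->
  \sum_(j in T) \sum_(l in T :\ j) F j l = 0.
Proof.
move=> FN.
pose G j l := if (l < j)%N then F j l else 0.
have FE j l : j \in T -> l \in T -> j != l -> F j l = G j l - G l j.
  move=> jT lT neq; rewrite /G; case: ltngtP => [lt|lt|/val_inj eq].
  - by rewrite subr0.
  - by rewrite sub0r; apply: FN.
  - by rewrite eq eqxx in neq.
have GE j : j \in T -> \sum_(l in T :\ j) F j l = \sum_(l in T) (G j l - G l j).
  move=> jT; rewrite [RHS](bigD1 j)//= subrr add0r.
  apply: congr_big => // l; rewrite !inE andbC// => /andP[lT neq].
  by apply: FE; rewrite // eq_sym.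
rewrite (eq_bigr _ GE) (eq_bigr _ (fun j _ => sumrB _ _ _ _)) sumrB.
by rewrite [X in _ - X]exchange_big subrr.
Qed.

Lemma koszul_diffK s m T : koszul_diff s (koszul_diff s m) T = 0.
Proof.
rewrite /koszul_diff; under eq_bigr do rewrite scaler_sumr.
apply: sum_antisymmetric => j l jT lT neq; rewrite !scalerA -scaleNr.
rewrite finset.setDDl finset.setUC -finset.setDDl; congr (_ *: _).
by rewrite mulrACA (cech_sign_swap jT lT neq); ring.
Qed.

End Koszul.

(** * Vanishing of the Koszul cohomology of P/Q *)

Section KoszulVanishing.
Variables (A : comNzRingType) (d : nat) (x : 'I_d -> A) (M : lmodType A).
Implicit Types (S T : {set 'I_d}) (j l : 'I_d) (m b : {set 'I_d} -> M).
Implicit Types (G P Q : nat -> M -> Prop).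

Local Notation kdiff := (koszul_diff x).
Local Notation xprod := (xprod x).

Lemma eq_koszul_diff s m m' T :
  (forall j, j \in T -> m (T :\ j) = m' (T :\ j)) -> kdiff s m T = kdiff s m' T.
Proof. by move=> eqm; apply: eq_bigr => j jT; rewrite eqm. Qed.

Lemma koszul_diffD s m m' T :
  kdiff s (fun S => m S + m' S) T = kdiff s m T + kdiff s m' T.
Proof. by rewrite -big_split; apply: eq_bigr => j _; rewrite scalerDr. Qed.

Lemma koszul_diffZ s a m T : kdiff s (fun S => a *: m S) T = a *: kdiff s m T.
Proof.
rewrite scaler_sumr; apply: eq_bigr => j _.
by rewrite !scalerA; congr (_ *: _); ring.
Qed.

Lemma koszul_diffB s m m' T :
  kdiff s (fun S => m S - m' S) T = kdiff s m T - kdiff s m' T.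
Proof.
rewrite -scaleN1r -koszul_diffZ -koszul_diffD.
by apply: eq_koszul_diff => j _; rewrite scaleN1r.
Qed.

(** Multiplication by [xprod S ^+ r] is the transition map of the colimit, from the Koszul complex
    on the x_j^s to the one on the x_j^(s+r). *)
Lemma koszul_diff_xprod s r m T :
  kdiff (s + r) (fun S => xprod S ^+ r *: m S) T = xprod T ^+ r *: kdiff s m T.
Proof.
rewrite scaler_sumr; apply: eq_bigr => j jT; rewrite !scalerA; congr (_ *: _).
by rewrite [in RHS]/Defs.xprod (big_setD1 j)//= exprMn exprD; ring.
Qed.

Definition graded_subgroup G :=
  [/\ forall mu, G mu 0,
      forall mu u v, G mu u -> G mu v -> G mu (u - v)
    & forall j mu u, G mu u -> G mu.+1 (x j *: u)].

Section Membership.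
Variables (G : nat -> M -> Prop) (subG : graded_subgroup G).

Lemma gsub0 mu : G mu 0. Proof. by have [] := subG. Qed.

Lemma gsubB mu u v : G mu u -> G mu v -> G mu (u - v).
Proof. by have [_ + _] := subG; apply. Qed.

Lemma gsubN mu u : G mu u -> G mu (- u).
Proof. by move=> Gu; rewrite -sub0r; apply: gsubB => //; apply: gsub0. Qed.

Lemma gsubD mu u v : G mu u -> G mu v -> G mu (u + v).
Proof. by move=> Gu Gv; rewrite -(opprK v); apply/gsubB/gsubN. Qed.

Lemma gsub_sign mu n u : G mu u -> G mu ((-1) ^+ n *: u).
Proof.
move=> Gu; rewrite -signr_odd; case: (odd n); last by rewrite expr0 scale1r.
by rewrite expr1 scaleN1r; apply: gsubN.
Qed.

Lemma gsub_exp mu nu j n u : G mu u -> nu = (mu + n)%N -> G nu (x j ^+ n *: u).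
Proof.
move=> Gu ->; elim: n => [|n IHn]; first by rewrite addn0 scale1r.
by rewrite addnS exprS -scalerA; have [_ _] := subG; apply.
Qed.

Lemma gsub_xprod mu nu r T u :
  G mu u -> nu = (mu + r * #|T|)%N -> G nu (xprod T ^+ r *: u).
Proof.
move=> Gu ->; rewrite /Defs.xprod -prodrXl -sum1_card big_distrr/=.
elim/big_rec2: _ => [|j n a _ IH]; first by rewrite addn0 scale1r.
by rewrite -scalerA; apply: gsub_exp IH _; lia.
Qed.

Lemma gsub_koszul_diff mu nu s m T :
  (forall S, #|S|.+1 = #|T| -> G (mu + s * #|S|)%N (m S)) ->
  nu = (mu + s * #|T|)%N -> G nu (kdiff s m T).
Proof.
move=> Gm ->; rewrite /koszul_diff.
elim/big_ind: _ => [|u v|j jT]; [exact: gsub0|exact: gsubD|].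
have cardT : #|T| = #|T :\ j|.+1 by rewrite (cardsD1 j) jT.
rewrite -scalerA; apply/gsub_sign/(gsub_exp _ (Gm _ (esym cardT))).
by rewrite cardT; lia.
Qed.

End Membership.

(* [koszul_cocycle] and [koszul_bounds] describe degree [mu] of the colimit over
   [s] of the Koszul complexes of P/Q on x_1^s, ..., x_d^s, that is, of the Cech
   complex of P/Q: m S stands for the fraction m S / (x_S)^s, and r is the
   number of steps along the colimit after which [m] becomes a boundary. *)
Definition koszul_cocycle P Q i mu s m :=
  (forall S, #|S| = i -> P (mu + s * i)%N (m S)) /\
  (forall T, #|T| = i.+1 -> Q (mu + s * i.+1)%N (kdiff s m T)).

Definition koszul_bounds P Q i mu s m := exists r b,
  (forall S, #|S|.+1 = i -> P (mu + (s + r) * #|S|)%N (b S)) /\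
  (forall T, #|T| = i ->
     Q (mu + (s + r) * i)%N (xprod T ^+ r *: m T - kdiff (s + r) b T)).

Definition koszul_vanishing P Q i mu :=
  forall s m, koszul_cocycle P Q i mu s m -> koszul_bounds P Q i mu s m.

(* The contracting homotopy of the Koszul complex for the element (x_j)^s. *)
Lemma koszul_torsion P Q i mu s m j :
  graded_subgroup P -> graded_subgroup Q -> koszul_cocycle P Q i mu s m ->
  koszul_bounds P Q i (mu + s)%N s (fun S => x j ^+ s *: m S).
Proof.
move=> subP subQ [Pm Qdm].
pose b S := if j \in S then 0 else cech_sign A j (j |: S) *: m (j |: S).
exists 0%N, b; split=> [S cardS|T cardT].
  rewrite /b; case: ifPn => jS; first exact: gsub0.
  apply: gsub_sign => //; have -> : (mu + s + (s + 0) * #|S| = mu + s * i)%N.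
    by lia.
  by apply: Pm; rewrite cardsU1 jS.
(* For j in T only the summand of index j survives, since [b] vanishes on sets containing j; it
   equals x_j^s m T. For j outside T the difference is, up to sign, the differential of m at
   [j |: T], which lies in Q. *)
rewrite addn0 scale1r; case: (boolP (j \in T)) => jT.
  rewrite [kdiff _ _ _](big_setD1 j)//= big1 => [|l].
    rewrite addr0 /b !inE eqxx /= finset.setD1K// scalerA.
    rewrite mulrAC cech_signK mul1r subrr; exact: gsub0.
  by rewrite /b !inE => /andP[neq lT]; rewrite eq_sym neq jT scaler0.
have -> : x j ^+ s *: m T - kdiff s b T =
          cech_sign A j (j |: T) *: kdiff s m (j |: T).
  rewrite [in RHS]/koszul_diff big_setU1//= finset.setU1K// scalerDr scalerA.
  rewrite mulrA cech_signK mul1r scaler_sumr; congr (_ + _).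
  rewrite /koszul_diff -sumrN; apply: eq_bigr => l lT.
  have neq : j != l by apply: contraNneq jT => ->.
  rewrite /b !inE (negPf jT) andbF scalerA -scaleNr.
  have eqT : j |: T :\ l = (j |: T) :\ l.
    by apply/setP => k; rewrite !inE; case: (eqVneq k j) => //= ->; rewrite neq.
  rewrite eqT scalerA; congr (_ *: _).
  have := @cech_sign_swap A d j l (j |: T).
  rewrite finset.setU1K// !inE eqxx lT orbT => /(_ isT isT neq).
  have := cech_signK A l T; have := cech_signK A l (j |: T).
  move: (cech_sign A j (j |: T)) (cech_sign A l T) (cech_sign A l (j |: T)).
  move: (cech_sign A j _) => e a b' c cc bb ab.
  have ac : a * c = - (b' * e).
    transitivity (a * b' * (b' * c)); first by rewrite -[LHS]mulr1 -bb; ring.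
    by rewrite ab -[b' * e]mulr1 -cc; ring.
  by rewrite [RHS]mulrA ac; ring.
apply: gsub_sign => //.
have -> : (mu + s + s * i = mu + s * i.+1)%N by lia.
by apply: Qdm; rewrite cardsU1 jT cardT.
Qed.

Section KillVariable.
Variables (P Q : nat -> M -> Prop) (j : 'I_d).
Hypotheses (subP : graded_subgroup P) (subQ : graded_subgroup Q).

Definition colon_piece mu u := P mu u /\ Q mu.+1 (x j *: u).

(** Degrees are natural numbers, so x_j P has nothing in degree 0; hence p = 0 there. *)
Definition sum_piece mu u := exists q p,
  [/\ Q mu q, if mu is nu.+1 then P nu p else p = 0 & u = q + x j *: p].

Lemma colon_piece_subgroup : graded_subgroup colon_piece.
Proof.
split=> [mu|mu u v [Pu Qu] [Pv Qv]|l mu u [Pu Qu]]; split.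
- exact: gsub0.
- by rewrite scaler0; apply: gsub0.
- exact: gsubB.
- by rewrite scalerBr; apply: gsubB.
- by have [_ _] := subP; apply.
- by rewrite scalerA mulrC -scalerA; have [_ _] := subQ; apply.
Qed.

Lemma sum_piece_subgroup : graded_subgroup sum_piece.
Proof.
split=> [mu|mu u v|l mu u].
- exists 0, 0; rewrite scaler0 addr0; split=> //; first exact: gsub0.
  by case: mu => // mu; apply: gsub0.
- move=> [q [p [Qq Pp ->]]] [q' [p' [Qq' Pp' ->]]].
  exists (q - q'), (p - p'); split; first exact: gsubB.
    by case: mu {Qq Qq'} Pp Pp' => [->->|mu]; [rewrite subrr|apply: gsubB].
  by rewrite scalerBr opprD addrACA.
- move=> [q [p [Qq Pp ->]]]; exists (x l *: q), (x l *: p); split.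
  + by have [_ _] := subQ; apply.
  + case: mu {Qq} Pp => [->|mu Pp]; last by have [_ _] := subP; apply.
    by rewrite scaler0; apply: gsub0.
  + by rewrite scalerDr !scalerA (mulrC (x j)).
Qed.

(* The connecting map of 0 -> (P'/Q)(-1) -> (P/Q)(-1) -> P/Q -> P/Q' -> 0, with
   P' = Q : x_j and Q' = Q + x_j P: a cocycle killed by x_j is, up to a boundary,
   a cocycle of P'/Q. *)
Lemma koszul_bounds_divide i mu s m :
  (forall k, koszul_vanishing colon_piece Q i (mu + k)) ->
  (forall i' k, koszul_vanishing P sum_piece i' (mu + k)) ->
  koszul_cocycle P Q i mu s m ->
  koszul_bounds P Q i mu.+1 s (fun S => x j *: m S) ->
  koszul_bounds P Q i mu s m.
Proof.
move=> van1 van2 [Pm Qdm] [r [b [Pb Qb]]].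
(* It suffices to correct m by a boundary so that x_j sends it into Q: the result [m1] is then a
   cocycle of [colon_piece] modulo Q, which bounds by [van1]. *)
suff [r1 [p [Pp Qp]]] : exists r1 p,
    (forall S, #|S|.+1 = i -> P (mu + (s + r1) * #|S|)%N (p S)) /\
    (forall T, #|T| = i -> Q (mu + (s + r1) * i).+1
       (x j *: (xprod T ^+ r1 *: m T - kdiff (s + r1) p T))).
  pose m1 S := xprod S ^+ r1 *: m S - kdiff (s + r1) p S.
  have P1 S : #|S| = i -> P (mu + (s + r1) * i)%N (m1 S).
    move=> cardS; apply: gsubB => //.
      by apply: (gsub_xprod subP (Pm _ cardS)); rewrite cardS; lia.
    by apply: gsub_koszul_diff => //; rewrite cardS => // S' /Pp.
  have Q1 T : #|T| = i.+1 -> Q (mu + (s + r1) * i.+1)%N (kdiff (s + r1) m1 T).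
    move=> cardT; rewrite koszul_diffB koszul_diff_xprod koszul_diffK subr0.
    by apply: (gsub_xprod subQ (Qdm _ cardT)); rewrite cardT; lia.
  have [|r2 [b2 [Pb2 Qb2]]] := van1 0%N (s + r1)%N m1.
    by rewrite addn0; split=> // S cardS; split; [apply: P1|apply: Qp].
  rewrite addn0 in Pb2 Qb2.
  exists (r1 + r2)%N, (fun S => xprod S ^+ r2 *: p S + b2 S).
  split=> [S cardS|T cardT].
    rewrite addnA; apply: gsubD => //; last by have [] := Pb2 _ cardS.
    by apply: (gsub_xprod subP (Pp _ cardS)); lia.
  have := Qb2 _ cardT; rewrite addnA koszul_diffD koszul_diff_xprod.
  by rewrite scalerBr scalerA -exprD (addnC r2) opprD addrA.
(* In cohomological degree 0 there are no boundaries, so x_j m already lies in Q after r steps. *)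
case: i => [|i] in van1 Pm Qdm Pb Qb *.
  exists r, (fun=> 0); split=> // T cardT; have := Qb _ cardT.
  rewrite (cards0_eq cardT) /koszul_diff !big_set0 !subr0 !scalerA.
  by rewrite (mulrC (x j)) !muln0 !addn0.
(* Modulo Q the differential of b is a multiple of x_j, so b is a cocycle of P modulo [sum_piece].
   That it bounds yields p such that, after r' steps, b is x_j p plus a boundary modulo Q. *)
have [|r' [b' [Pb' Qb']]] := van2 i 1%N (s + r)%N b.
  rewrite addn1; split=> [S cardS|T cardT].
    by have := Pb S; rewrite cardS; apply.
  exists (- (xprod T ^+ r *: (x j *: m T) - kdiff (s + r) b T)).
  exists (xprod T ^+ r *: m T); split.
  - by apply/(gsubN subQ)/Qb.
  - by rewrite addSn; apply: (gsub_xprod subP (Pm _ cardT)); rewrite cardT; lia.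
  - by rewrite opprB !scalerA (mulrC (x j)) subrK.
have /choice[p Hp] S : exists p, #|S| = i ->
    P (mu + (s + r + r') * i)%N p /\
    Q (mu + (s + r + r') * i).+1 (xprod S ^+ r' *: b S
      - kdiff (s + r + r') b' S - x j *: p).
  have [cardS|/eqP neq] := eqVneq #|S| i; last by exists 0.
  have := Qb' _ cardS; rewrite addn1 addSn => -[q [p [Qq Pp ->]]].
  by exists p; rewrite addrK.
exists (r + r')%N, p; rewrite addnA; split=> [S [cardS]|T cardT].
  by rewrite cardS; have [] := Hp S cardS.
have -> : x j *: (xprod T ^+ (r + r') *: m T - kdiff (s + r + r') p T) =
  xprod T ^+ r' *: (xprod T ^+ r *: (x j *: m T) - kdiff (s + r) b T) +
  kdiff (s + r + r') (fun S => xprod S ^+ r' *: b S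
    - kdiff (s + r + r') b' S - x j *: p S) T.
  rewrite !koszul_diffB koszul_diffK subr0 koszul_diff_xprod koszul_diffZ.
  rewrite !scalerBr !scalerA addrA subrK exprD; congr (_ *: _ - _); ring.
rewrite -addSn; apply: gsubD => //.
  by apply: (gsub_xprod subQ (Qb _ cardT)); rewrite cardT; lia.
apply: (@gsub_koszul_diff _ subQ mu.+1); rewrite ?cardT// => S [cardS].
by rewrite cardS addSn; have [] := Hp S cardS.
Qed.

(** By [koszul_torsion] a power of x_j kills the class; the factors x_j are then removed one at a
    time by [koszul_bounds_divide]. *)
Lemma koszul_vanishing_extension B :
  (forall i mu, (B <= mu)%N -> koszul_vanishing colon_piece Q i mu) ->
  (forall i mu, (B <= mu)%N -> koszul_vanishing P sum_piece i mu) ->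
  forall i mu, (B <= mu)%N -> koszul_vanishing P Q i mu.
Proof.
move=> van1 van2 i mu leB s m cyc_m.
suff bounds k : koszul_bounds P Q i (mu + k)%N s (fun S => x j ^+ k *: m S) ->
    koszul_bounds P Q i mu s m.
  exact: bounds (koszul_torsion j subP subQ cyc_m).
have exp0 : (fun S => x j ^+ 0 *: m S) = m.
  by apply/funext => S; rewrite scale1r.
elim: k => [|k IHk bk]; first by rewrite addn0 exp0.
apply: IHk; apply: koszul_bounds_divide => [k'|i' k'||].
- by apply: van1; lia.
- by apply: van2; lia.
- case: cyc_m => Pm Qdm; split=> [S cardS|T cardT].
    by apply: (gsub_exp subP _ (Pm _ cardS)); lia.
  by rewrite koszul_diffZ; apply: (gsub_exp subQ _ (Qdm _ cardT)); lia.
- move: bk; rewrite addnS; congr koszul_bounds.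
  by apply/funext => S; rewrite scalerA exprS.
Qed.

End KillVariable.

(** The numerators of a cochain of degree mu have degree at least mu, where P is contained in Q. *)
Lemma koszul_vanishing_killed P Q mu :
  graded_subgroup P -> graded_subgroup Q ->
  (forall nu u, (mu <= nu)%N -> P nu u -> Q nu u) ->
  forall i, koszul_vanishing P Q i mu.
Proof.
move=> subP subQ PQ i s m [Pm Qdm]; exists 1%N, (fun=> 0).
split=> [S _|T cardT]; first exact: gsub0.
rewrite [kdiff _ _ _]big1 ?subr0 => [|j _]; last by rewrite scaler0.
by apply: PQ; [lia|apply: (gsub_xprod subP (Pm _ cardT)); rewrite cardT; lia].
Qed.

End KoszulVanishing.

(** * Hilbert's basis theorem for modules with operators *)

Section AscendingChains.

Definition acc (T : Type) (C : (T -> Prop) -> Prop) :=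
  forall U : nat -> T -> Prop, (forall m, C (U m)) ->
    (forall m u, U m u -> U m.+1 u) ->
  exists m0, forall m u, U m u -> U m0 u.

Lemma chain_le (T : Type) (U : nat -> T -> Prop) :
  (forall m u, U m u -> U m.+1 u) ->
  forall m n u, (m <= n)%N -> U m u -> U n u.
Proof.
move=> mono m n u /subnK <- Um; elim: (n - m)%N => // k IHk.
by rewrite addSn; apply: mono.
Qed.

(** F turns a chain in C' into a chain in C, which is stationary; as F reflects inclusions between
    comparable members, the original chain is stationary too. *)
Lemma acc_transfer (T T' : Type) (C : (T -> Prop) -> Prop)
    (C' : (T' -> Prop) -> Prop) (F : (T' -> Prop) -> T -> Prop) :
  (forall U, C' U -> C (F U)) ->
  (forall U U', C' U -> C' U' -> (forall u, U u -> U' u) ->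
    (forall v, F U v -> F U' v) /\
    ((forall v, F U' v -> F U v) -> forall u, U' u -> U u)) ->
  acc C -> acc C'.
Proof.
move=> CF Finj accC U CU monoU.
have [m|m v|m0 Fm0] := accC (fun m => F (U m)); first exact: CF.
  by have [+ _] := Finj _ _ (CU m) (CU m.+1) (monoU m); apply.
exists m0 => m u Um; have [/(chain_le monoU)/(_ Um)//|lt_m0] := leqP m m0.
have le u := @chain_le _ _ monoU _ _ u (ltnW lt_m0).
have [_] := Finj _ _ (CU m0) (CU m) le.
by apply=> // v; apply: Fm0.
Qed.

(** The diagonal is stationary from some d0 on, which settles every i >= d0; each of the finitely
    many i < d0 is settled by its own chain. *)
Lemma acc_double (T : Type) (C : (T -> Prop) -> Prop)
    (L : nat -> nat -> T -> Prop) :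
  acc C -> (forall m i, C (L m i)) ->
  (forall m i u, L m i u -> L m.+1 i u) ->
  (forall m i u, L m i u -> L m i.+1 u) ->
  exists m0, forall m i u, L m i u -> L m0 i u.
Proof.
move=> accC CL mono1 mono2.
have le1 i := @chain_le _ (fun m => L m i) (fun m => mono1 m i).
have le2 m := @chain_le _ (L m) (mono2 m).
have [||d0 Hd0] := accC (fun m => L m m) => [m|m u Lm|]; first exact: CL.
  by apply/mono1/mono2.
have [h Hh] : exists h, forall i m u, (i < d0)%N -> L m i u -> L h i u.
  elim: d0 {Hd0} => [|n [h Hh]]; first by exists 0%N.
  have [|h' Hh'] := accC (fun m => L m n) (fun m => CL m n).
    by move=> m; apply: mono1.
  exists (maxn h h') => i m u; rewrite ltnS leq_eqVlt => /predU1P[->|lt_in] Lm.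
    by apply: le1 (Hh' _ _ Lm); rewrite leq_maxr.
  by apply: le1 (Hh _ _ _ lt_in Lm); rewrite leq_maxl.
exists (maxn d0 h) => m i u Lm; have [le_d0i|lt_id0] := leqP d0 i.
  apply: (le1 _ d0); first exact: leq_maxl.
  apply: (le2 _ d0) => //; apply: (Hd0 (maxn m i)).
  by apply: (le1 _ m); [exact: leq_maxl|apply: (le2 _ i) => //; exact: leq_maxr].
by apply: le1 (Hh _ _ _ lt_id0 Lm); rewrite leq_maxr.
Qed.

End AscendingChains.

Section HilbertBasis.
Variable V : zmodType.
Implicit Types (U W : V -> Prop) (Om : (V -> V) -> Prop) (f g : V -> V).

Lemma op0 f : (forall u v, f (u - v) = f u - f v) -> f 0 = 0.
Proof. by move=> addf; have := addf 0 0; rewrite !subrr. Qed.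

Lemma opD f : (forall u v, f (u - v) = f u - f v) ->
  forall u v, f (u + v) = f u + f v.
Proof.
move=> addf u v; rewrite -{1}(opprK v) addf; congr (_ + _).
by rewrite -(sub0r v) addf (op0 addf) sub0r opprK.
Qed.

(** With scalings and commuting operators, these are the submodules over a polynomial ring whose
    variables act as the operators; the ring itself is never constructed. *)
Definition operator_submodule Om U :=
  [/\ U 0, forall u v, U u -> U v -> U (u - v)
    & forall g u, Om g -> U u -> U (g u)].

Definition operator_noetherian Om W :=
  acc (fun U => operator_submodule Om U /\ forall u, U u -> W u).

Definition adjoin Om f g := Om g \/ g = f.

Definition additive_ops Om := forall g, Om g -> forall u v, g (u - v) = g u - g v.

Section Submodules.
Variables (Om : (V -> V) -> Prop) (U : V -> Prop).
Hypothesis subU : operator_submodule Om U.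

Lemma osub0 : U 0. Proof. by have [] := subU. Qed.

Lemma osubB u v : U u -> U v -> U (u - v).
Proof. by have [_ + _] := subU; apply. Qed.

Lemma osub_op g u : Om g -> U u -> U (g u).
Proof. by have [_ _] := subU; apply. Qed.

Lemma osubN u : U u -> U (- u).
Proof. by move=> Uu; rewrite -sub0r; apply: osubB => //; exact: osub0. Qed.

Lemma osubD u v : U u -> U v -> U (u + v).
Proof. by move=> Uu Uv; rewrite -(opprK v); apply/osubB/osubN. Qed.

Lemma osub_sum (I : Type) (r : seq I) (P : pred I) (F : I -> V) :
  (forall i, P i -> U (F i)) -> U (\sum_(i <- r | P i) F i).
Proof. by move=> UF; elim/big_ind: _ => //; [exact: osub0|exact: osubD]. Qed.

End Submodules.

Section Adjoin.
Variables (Om : (V -> V) -> Prop) (W : V -> Prop) (f : V -> V).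
Hypotheses (addOm : additive_ops Om) (addf : forall u v, f (u - v) = f u - f v).
Hypothesis (commf : forall g, Om g -> forall u, f (g u) = g (f u)).
Hypothesis (subW : operator_submodule Om W).

Lemma iter_opB i u v : iter i f (u - v) = iter i f u - iter i f v.
Proof. by elim: i => //= i ->. Qed.

Lemma iter_op0 i : iter i f 0 = 0.
Proof. exact/op0/iter_opB. Qed.

Lemma iter_op_comm i g u : Om g -> iter i f (g u) = g (iter i f u).
Proof. by move=> Omg; elim: i => //= i ->; apply: commf. Qed.

(** This is W + f W + ... + f^(i-1) W, the analogue of the polynomials of degree below i. *)
Fixpoint layer i : V -> Prop :=
  if i is i'.+1 then
    fun v => exists u w, [/\ layer i' u, W w & v = u + iter i' f w]
  else fun v => v = 0.

Lemma layer_submodule i : operator_submodule Om (layer i).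
Proof.
elim: i => [|i IHi]; first split=> [//|_ _ -> ->|g _ /addOm Omg ->].
- by rewrite subrr.
- exact: op0.
split=> [|u v|g u Omg].
- by exists 0, 0; split; [exact: osub0 IHi|exact: osub0 subW|rewrite iter_op0 addr0].
- move=> [u1 [w1 [Lu1 Ww1 ->]]] [u2 [w2 [Lu2 Ww2 ->]]].
  exists (u1 - u2), (w1 - w2); split; first exact: osubB IHi _ _ _ _.
    exact: osubB subW _ _ _ _.
  by rewrite iter_opB opprD addrACA.
- case=> u1 [w1 [Lu1 Ww1 ->]]; exists (g u1), (g w1); split.
  + exact: osub_op IHi _ _ _ _.
  + exact: osub_op subW _ _ _ _.
  + by rewrite iter_op_comm// (opD (addOm Omg)).
Qed.

Lemma layerS i u : layer i u -> layer i.+1 u.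
Proof. by exists u, 0; split=> //; [exact: osub0 subW|rewrite iter_op0 addr0]. Qed.

Lemma layer_op i u : layer i u -> layer i.+1 (f u).
Proof.
elim: i u => [_ ->|i IHi _ [v [w [Lv Ww ->]]]].
  by rewrite (op0 addf); exact: (osub0 (layer_submodule 1)).
by exists (f v), w; split=> //; [exact: IHi|rewrite (opD addf)].
Qed.

Definition layers u := exists i, layer i u.

Lemma layers_submodule : operator_submodule (adjoin Om f) layers.
Proof.
have layer_le := chain_le layerS.
split=> [|u v [i Lu] [j Lv]|g u Omg [i Lu]]; first by exists 0%N.
  exists (maxn i j); apply: (osubB (layer_submodule _)).
    by apply: layer_le Lu; rewrite leq_maxl.
  by apply: layer_le Lv; rewrite leq_maxr.
case: Omg => [Omg|->]; last by exists i.+1; apply: layer_op.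
by exists i; apply: (osub_op (layer_submodule _)).
Qed.

(* The analogue of the ideal of leading coefficients in Hilbert's proof. *)
Definition leading U i w :=
  W w /\ exists u v, [/\ U u, layer i v & iter i f w = u + v].

Lemma leading_submodule U i :
  operator_submodule Om U -> operator_submodule Om (leading U i).
Proof.
move=> subU; have subL := layer_submodule i.
split=> [|w w' [Ww [u [v [Uu Lv e]]]] [Ww' [u' [v' [Uu' Lv' e']]]]|g w Omg].
- split; first exact: osub0 subW.
  exists 0, 0; split; [exact: osub0 subU|exact: osub0 subL|].
  by rewrite iter_op0 addr0.
- split; first exact: osubB subW _ _ _ _.
  exists (u - u'), (v - v'); split; first exact: osubB subU _ _ _ _.
    exact: osubB subL _ _ _ _.
  by rewrite iter_opB e e' opprD addrACA.
- move=> [Ww [u [v [Uu Lv e]]]]; split; first exact: osub_op subW _ _ _ _.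
  exists (g u), (g v); split; first exact: osub_op subU _ _ _ _.
    exact: osub_op subL _ _ _ _.
  by rewrite iter_op_comm// e (opD (addOm Omg)).
Qed.

Lemma leadingS U i w :
  operator_submodule (adjoin Om f) U -> leading U i w -> leading U i.+1 w.
Proof.
move=> subU [Ww [u [v [Uu Lv e]]]]; split=> //; exists (f u), (f v); split.
- by apply: (osub_op subU) => //; right.
- exact: layer_op.
- by rewrite /= e (opD addf).
Qed.

(** Induction on the layer: the leading coefficient of an element u of U' in layer i+1 also occurs
    in U, for some u1; then u - u1 lies in U' and in layer i. *)
Lemma leading_inj U U' :
  operator_submodule (adjoin Om f) U -> operator_submodule (adjoin Om f) U' ->
  (forall u, U u -> U' u) -> (forall u, U' u -> layers u) ->
  (forall i w, leading U' i w -> leading U i w) -> forall u, U' u -> U u.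
Proof.
move=> subU subU' UU' U'L lead u U'u; have [i Lu] := U'L _ U'u; move: U'u Lu.
elim: i u => [u _ ->|i IHi u U'u [v [w [Lv Ww eu]]]]; first exact: osub0 subU.
move: U'u; rewrite eu => U'vw; have [|_ [u1 [v1 [Uu1 Lv1 e]]]] := lead i w.
  split=> //; exists (v + iter i f w), (- v).
  by split=> //; [exact: osubN (layer_submodule i) _ _|rewrite addrC addKr].
have -> : v + iter i f w = u1 + (v + v1) by rewrite e addrCA.
apply: (osubD subU) => //; apply: IHi; last exact: osubD (layer_submodule i) _ _ _ _.
have -> : v + v1 = v + iter i f w - u1 by rewrite e (addrC u1) addrA addrK.
by apply: (osubB subU') => //; apply: UU'.
Qed.

(** The leading coefficients of [U m] in degree i increase with m and with i, so [acc_double] gives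
    one m0 valid for all i, and [leading_inj] concludes. *)
Lemma adjoin_noetherian :
  operator_noetherian Om W -> operator_noetherian (adjoin Om f) layers.
Proof.
move=> noethW U subU monoU.
have subOm m : operator_submodule Om (U m).
  have [[U0 UB Uop] _] := subU m.
  by split=> // g u Omg; apply: Uop; left.
have [|||m0 Hm0] := @acc_double _ _ (fun m => leading (U m)) noethW.
- by move=> m i; split; [exact: leading_submodule|move=> w []].
- move=> m i w [Ww [u [v [Uu Lv e]]]]; split=> //.
  by exists u, v; split=> //; apply: monoU.
- by move=> m i w; apply: leadingS; have [] := subU m.
exists m0 => m u Um; have [le|/ltnW le] := leqP m m0; first exact: (chain_le monoU le).
have [sub _] := subU m; have [sub0 _] := subU m0.
apply: (leading_inj sub0 sub) Um => [v|v|i w]; [exact: (chain_le monoU le)| |exact: Hm0].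
by have [_] := subU m; apply.
Qed.

End Adjoin.

Definition adjoin_family (K : eqType) Om (F : K -> V -> V) (s : seq K) g :=
  Om g \/ exists2 k, k \in s & g = F k.

Lemma adjoin_family_cons (K : eqType) Om (F : K -> V -> V) k s :
  adjoin_family (adjoin Om (F k)) F s = adjoin_family Om F (k :: s).
Proof.
apply/predeqP => g; split=> [[[|->]|[l ls ->]]|[Og|[l]]].
- by left.
- by right; exists k; rewrite ?mem_head.
- by right; exists l; rewrite // inE ls orbT.
- by left; left.
- by rewrite inE => /predU1P[->|ls] ->; [left; right|right; exists l].
Qed.

(** The operators are adjoined one at a time, each commuting with all the previous ones, as when the
    variables of a polynomial ring are added successively. *)
Lemma hilbert_basis (K : eqType) Om (F : K -> V -> V) (s : seq K) W :
  additive_ops Om -> (forall k u v, F k (u - v) = F k u - F k v) ->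
  (forall k g, Om g -> forall u, F k (g u) = g (F k u)) ->
  (forall k l u, F k (F l u) = F l (F k u)) ->
  operator_submodule Om W -> operator_noetherian Om W ->
  exists W', [/\ forall u, W u -> W' u,
    operator_submodule (adjoin_family Om F s) W' &
    operator_noetherian (adjoin_family Om F s) W'].
Proof.
move=> + addF + commF.
elim: s Om W => [|k s IHs] Om W addOm commOm subW noethW.
  have -> : adjoin_family Om F [::] = Om; last by exists W.
  by apply/predeqP => g; split=> [[//|[]//]|Og]; left.
have [||||W' [WW' subW' noethW']] := IHs (adjoin Om (F k)) (layers W (F k)).
- by move=> g [Og|->]; [apply: addOm|apply: addF].
- by move=> l g [Og|->] u; [apply: commOm|apply: commF].
- by apply: layers_submodule => // g Og u; apply: commOm.
- by apply: adjoin_noetherian => // g Og u; apply: commOm.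
exists W'; rewrite -adjoin_family_cons; split=> // u Wu; apply: WW'.
by exists 1%N, 0, u; split=> //; rewrite add0r.
Qed.

End HilbertBasis.

(** * Finitely generated modules over a Noetherian ring *)

Definition scaling (A : comNzRingType) (M : lmodType A) (g : M -> M) :=
  exists a : A, g = fun u => a *: u.

Lemma scaling_submodule (A : comNzRingType) (M : lmodType A) (U : M -> Prop) :
  U 0 -> (forall a u v, U u -> U v -> U (a *: u + v)) ->
  operator_submodule (@scaling A M) U.
Proof.
move=> U0 UD; split=> [//|u v Uu Uv|_ u [a ->] Uu].
  by rewrite addrC -scaleN1r; apply: UD.
by rewrite -[_ *: u]addr0; apply: UD.
Qed.

Section Span.
Variables (A : comNzRingType) (M : lmodType A).

Lemma mem_span (G : set M) v : G v -> v \in Defs.span G.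
Proof.
move=> Gv; apply/asboolP; exists 1%N, (fun=> 1), (fun=> v).
by rewrite big_ord1 scale1r.
Qed.

Lemma span_sub (G : set M) (U : M -> Prop) :
  operator_submodule (@scaling A M) U -> (forall v, G v -> U v) ->
  forall v, v \in Defs.span G -> U v.
Proof.
move=> subU GU v /asboolP[n [c [g [Gg ->]]]].
by apply: (osub_sum subU) => i _; apply: (osub_op subU); [exists (c i)|apply: GU].
Qed.

End Span.

Section Noetherian.
Variables (A : comNzRingType).
Hypothesis noethA : noetherian A.

Lemma noetherian_ideals : acc (operator_submodule (@scaling A A^o)).
Proof.
move=> U subU monoU; pose Uinf : set A^o := fun a => exists m, U m a.
have [s Hs] := noethA (Defs.span Uinf).
have le := chain_le monoU.
have [m0 Hm0] : exists m0, forall a, a \in s -> U m0 a.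
  have: forall a, a \in s -> exists m, U m a.
    move=> a as'; have /asboolP[n [c [h [Hh ->]]]] : a \in Defs.span Uinf.
      by rewrite Hs; apply: mem_span.
    have /choice[k Hk] i : exists k, U k (h i) := Hh i.
    exists (\max_i k i)%N; apply: (osub_sum (subU _)) => i _.
    apply: (osub_op (subU _)); first by exists (c i).
    by apply: le (Hk i); apply: leq_bigmax.
  elim: s {Hs} => [|a s IHs] Us; first by exists 0%N.
  have [|m1 Hm1] := IHs; first by move=> b bs; apply: Us; rewrite inE bs orbT.
  have [m2 Hm2] := Us a (mem_head a s).
  exists (maxn m1 m2) => b; rewrite inE => /predU1P[->|bs].
    by apply: le Hm2; rewrite leq_maxr.
  by apply: le (Hm1 _ bs); rewrite leq_maxl.
exists m0 => m u Um; have : u \in Defs.span Uinf by apply: mem_span; exists m.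
by rewrite Hs; apply: (span_sub (subU m0)).
Qed.

Variable M : lmodType A.

Fixpoint combinations (s : seq M) : M -> Prop :=
  if s is g :: s' then
    fun v => exists a u, combinations s' u /\ v = a *: g + u
  else fun v => v = 0.

Lemma combinations_submodule s : operator_submodule (@scaling A M) (combinations s).
Proof.
apply: scaling_submodule; elim: s => [|g s IHs] //=.
- by exists 0, 0; rewrite scale0r addr0.
- by move=> a _ _ -> ->; rewrite scaler0 addr0.
- move=> a _ _ [b [u [Cu ->]]] [c [v [Cv ->]]].
  exists (a * b + c), (a *: u + v); split; first exact: IHs.
  by rewrite scalerDr scalerDl scalerA addrACA.
Qed.

Lemma mem_combinations s v : v \in s -> combinations s v.
Proof.
elim: s => //= g s IHs; rewrite inE => /predU1P[->|/IHs Cv].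
  by exists 1, 0; split; [exact: osub0 (combinations_submodule s)|rewrite scale1r addr0].
by exists 0, v; rewrite scale0r add0r.
Qed.

(** Induction on the generators: along a chain, U is determined by its intersection with the
    combinations of the remaining generators and by the ideal of coefficients of g, and both are
    stationary. *)
Lemma noetherian_combinations s : operator_noetherian (@scaling A M) (combinations s).
Proof.
elim: s => [|g s IHs] U CU monoU.
  by exists 0%N => m u /(proj2 (CU m)) ->; apply: osub0 (CU 0%N).1.
have le := chain_le monoU; have subC := combinations_submodule s.
have [||m1 Hm1] := IHs (fun m u => U m u /\ combinations s u).
- move=> m; have [U0 UB UZ] := (CU m).1; have [C0 CB CZ] := subC.
  split=> [|u []//]; split=> [//|u v [Uu Cu] [Uv Cv]|h u Oh [Uu Cu]].
    by split; [apply: UB|apply: CB].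
  by split; [apply: UZ|apply: CZ].
- by move=> m u [Uu Cu]; split=> //; apply: monoU.
have [||m2 Hm2] := noetherian_ideals (U := fun m a =>
    exists u, combinations s u /\ U m ((a : A) *: g + u)).
- move=> m; have subU := (CU m).1; apply: scaling_submodule.
    by exists 0; rewrite scale0r addr0; split; [exact: osub0 subC|exact: osub0 subU].
  move=> a b c [u [Cu Uu]] [v [Cv Uv]]; exists (a *: u + v); split.
    by apply: (osubD subC) => //; apply: (osub_op subC) => //; exists a.
  have -> : (a *: b + c : A) *: g + (a *: u + v) = a *: (b *: g + u) + (c *: g + v).
    by rewrite scalerDr !scalerDl scalerA addrACA.
  by apply: (osubD subU) => //; apply: (osub_op subU) => //; exists a.
- by move=> m a [u [Cu Uu]]; exists u; split=> //; apply: monoU.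
exists (maxn m1 m2) => m w Uw; have [a [u [Cu ew]]] := (CU m).2 _ Uw.
have [|v [Cv Uv]] := Hm2 m a; first by exists u; rewrite -ew.
have {}Uv := le _ _ _ (leq_maxr m1 m2) Uv.
suff Uuv : U (maxn m1 m2) (u - v).
  have -> : w = (a *: g + v) + (u - v) by rewrite ew -addrA [v + _]addrC subrK.
  exact: osubD (CU _).1 _ _ _ _.
have [|Uuv _] := Hm1 (maxn m (maxn m1 m2)) (u - v); last first.
  exact: le (leq_maxl _ _) Uuv.
split; last exact: osubB subC _ _ _ _.
have -> : u - v = w - (a *: g + v) by rewrite ew opprD addrACA subrr add0r.
apply: (osubB (CU _).1); first exact: le (leq_maxl _ _) Uw.
exact: le (leq_maxr _ _) Uv.
Qed.

Lemma noetherian_submodules :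
  finitely_generated (fullsub M) -> acc (operator_submodule (@scaling A M)).
Proof.
move=> [s Hs] U subU; apply: noetherian_combinations => m; split=> // u _.
have : u \in fullsub M by apply: mem_span.
by rewrite Hs; apply: (span_sub (combinations_submodule s)) => v /mem_combinations.
Qed.

End Noetherian.

(** * Projections onto homogeneous components *)

Section HomogeneousComponents.
Variables (V : zmodType) (g : nat -> set V).
Hypothesis gV : direct_decomposition g.

Definition decomposes v n (c : nat -> V) :=
  [/\ forall i, g i (c i), forall i, (n <= i)%N -> c i = 0
    & v = \sum_(i < n) c i].

Lemma decomposes_exists v : exists c, exists n, decomposes v n c.
Proof.
have [gsub gen _] := gV; have [n [c [gc ->]]] := gen v.
exists (fun i => if (i < n)%N then c i else 0), n; split=> [i|i|].
- by case: ifP => // _; have [] := gsub i.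
- by rewrite leqNgt => /negPf->.
- by apply: eq_bigr => i _; rewrite ltn_ord.
Qed.

Lemma decomposes_widen v n n' c :
  (n <= n')%N -> decomposes v n c -> decomposes v n' c.
Proof.
move=> le [gc c0 ->]; split=> // [i lei|]; first by apply/c0/(leq_trans le).
rewrite (big_ord_widen _ c le) big_mkcond; apply: eq_bigr => i _.
by case: ltnP => // /c0.
Qed.

Lemma decomposes_uniq v n n' c c' :
  decomposes v n c -> decomposes v n' c' -> c = c'.
Proof.
move=> /(decomposes_widen (leq_maxl n n'))[gc c0 vc].
move=> /(decomposes_widen (leq_maxr n n'))[gc' c0' vc'].
have [gsub _ uniq] := gV.
apply/funext => i; have [lt_i|le_i] := ltnP i (maxn n n'); last by rewrite c0 ?c0'.
apply/eqP; rewrite -subr_eq0; apply/eqP.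
apply: (uniq _ (fun i => c i - c' i)) lt_i => [j|]; first by have [_ +] := gsub j; apply.
by rewrite sumrB -vc -vc' subrr.
Qed.

(** Decompositions are chosen element by element; their uniqueness makes the resulting projections
    additive. *)
Lemma homogeneous_components : exists comp : nat -> V -> V,
  [/\ forall i v, g i (comp i v),
      forall i u v, comp i (u - v) = comp i u - comp i v,
      forall i j u, g j u -> comp i u = if i == j then u else 0
    & forall v, exists n, v = \sum_(i < n) comp i v].
Proof.
have [gsub _ _] := gV.
have /choice[c Hc] := decomposes_exists; exists (fun i v => c v i).
split=> [i v|i u v|i j u gu|v].
- by have [n [+ _ _]] := Hc v; apply.
- have [n Hn] := Hc u; have [n' Hn'] := Hc v; have [n2 Hn2] := Hc (u - v).
  have [gc c0 vc] := decomposes_widen (leq_maxl n n') Hn.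
  have [gc' c0' vc'] := decomposes_widen (leq_maxr n n') Hn'.
  suff Huv : decomposes (u - v) (maxn n n') (fun i => c u i - c v i).
    by rewrite (decomposes_uniq Hn2 Huv).
  split=> [k|k lek|]; first by have [_ +] := gsub k; apply.
    by rewrite c0// c0'// subrr.
  by rewrite sumrB -vc -vc'.
- have [n Hn] := Hc u.
  suff Hu : decomposes u j.+1 (fun i => if i == j then u else 0).
    by rewrite (decomposes_uniq Hn Hu).
  split=> [k|k lek|]; first by case: eqP => [->//|_]; have [] := gsub k.
    by rewrite gtn_eqF.
  by rewrite big_ord_recr/= eqxx big1 ?add0r// => k _; rewrite ltn_eqF.
- by have [n [_ _ ?]] := Hc v; exists n.
Qed.

End HomogeneousComponents.

(** * Multigraded families *)

Section MultigradedFamilies.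
Variables (A : comNzRingType) (gA : ring_grading A) (d : nat) (x : 'I_d -> A).
Hypotheses (x_deg1 : forall i, gA 1%N (x i))
  (x_gen : generates_over_deg0 gA (range x)).
Variables (M : lmodType A) (gM : mod_grading gA M) (t : nat).

(* (j, e, a) stands for a generator a of the ideal I_j, of degree e. *)
Definition generator : Type := ('I_t * nat * A)%type.
Variable gens : seq generator.
Hypothesis gens_homogeneous : forall k, k \in gens -> gA k.1.2 k.2.

Local Notation multidegree := {ffun 'I_t -> nat}.
Implicit Types (n : multidegree) (mu : nat) (j : 'I_t) (k : generator).

Definition incr j n : multidegree := [ffun i => (i == j) + n i]%N.
Definition decr j n : multidegree := [ffun i => n i - (i == j)]%N.

Lemma incrK j : cancel (incr j) (decr j).
Proof. by move=> n; apply/ffunP => i; rewrite !ffunE addKn. Qed.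

Lemma decrK j n : (0 < n j)%N -> incr j (decr j n) = n.
Proof.
move=> n0; apply/ffunP => i; rewrite !ffunE.
by case: eqP => [->|_]; rewrite ?subn0// subn1 add1n prednK.
Qed.

Definition family := multidegree -> nat -> M -> Prop.
Implicit Types P Q : family.

(** Such families are the multigraded modules over A_0[x, y_k : k in [gens]] inside copies of M,
    where y_k acts as the generator k = (j, e, a) and has multidegree e_j and degree e. *)
Definition stable_family P :=
  [/\ forall n, graded_subgroup x (P n),
      forall n mu a u, gA 0%N a -> P n mu u -> P n mu (a *: u)
    & forall n mu k u, k \in gens -> P n mu u ->
        P (incr k.1.1 n) (mu + k.1.2)%N (k.2 *: u)].

Lemma colon_family_stable P Q (j : 'I_d) : stable_family P -> stable_family Q ->
  stable_family (fun n => colon_piece x (P n) (Q n) j).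
Proof.
move=> [subP P0 Pk] [subQ Q0 Qk]; split=> [n|n mu a u ga [Pu Qu]|n mu k u ks [Pu Qu]].
- exact: colon_piece_subgroup.
- by split; [apply: P0|rewrite scalerA mulrC -scalerA; apply: Q0].
- by split; [apply: Pk|rewrite scalerA mulrC -scalerA -addSn; apply: Qk].
Qed.

Lemma sum_family_stable P Q (j : 'I_d) : stable_family P -> stable_family Q ->
  stable_family (fun n => sum_piece x (P n) (Q n) j).
Proof.
move=> [subP P0 Pk] [subQ Q0 Qk]; split=> [n|n mu a u ga|n mu k u ks].
- exact: sum_piece_subgroup.
- move=> [q [p [Qq Pp ->]]]; exists (a *: q), (a *: p); split; first exact: Q0.
    by case: mu {Qq} Pp => [->|mu]; [rewrite scaler0|apply: P0].
  by rewrite scalerDr !scalerA mulrC.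
- move=> [q [p [Qq Pp ->]]]; exists (k.2 *: q), (k.2 *: p); split; first exact: Qk.
    case: mu {Qq} Pp => [->|mu Pp]; last by apply: Pk.
    by rewrite scaler0; case: (0 + _)%N => // nu; apply: gsub0.
  by rewrite scalerDr !scalerA mulrC.
Qed.

Let V := multidegree -> M.

Definition single n u : V := fun n' => if n' == n then u else 0.

(** The action of y_k. The test on n matters because [decr] truncates at 0. *)
Definition shift k (v : V) : V :=
  fun n => if (0 < n k.1.1)%N then k.2 *: v (decr k.1.1 n) else 0.

Lemma shift_single k n u : shift k (single n u) = single (incr k.1.1 n) (k.2 *: u).
Proof.
apply/funext => n'; rewrite /shift /single; case: ifP => [n0|n0].
  have -> : (decr k.1.1 n' == n) = (n' == incr k.1.1 n).
    by apply/eqP/eqP => [<-|->]; rewrite ?decrK ?incrK.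
  by case: ifP => //; rewrite scaler0.
by case: eqP n0 => // ->; rewrite ffunE eqxx.
Qed.

Lemma shiftB k (u v : V) : shift k (u - v) = shift k u - shift k v.
Proof.
apply/funext => n; have subE (w w' : V) i : (w - w') i = w i - w' i by [].
rewrite subE /shift; case: ifP => _; last by rewrite subr0.
by rewrite subE scalerBr.
Qed.

Lemma shiftZ k a (v : V) : shift k (a *: v) = a *: shift k v.
Proof.
apply/funext => n; have scaleE (w : V) i : (a *: w) i = a *: w i by [].
rewrite scaleE /shift; case: ifP => _; last by rewrite scaler0.
by rewrite scaleE !scalerA mulrC.
Qed.

Lemma shift_comm k l (v : V) : shift k (shift l v) = shift l (shift k v).
Proof.
apply/funext => n; rewrite /shift.
have -> : decr l.1.1 (decr k.1.1 n) = decr k.1.1 (decr l.1.1 n).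
  by apply/ffunP => i; rewrite !ffunE subnAC.
rewrite !ffunE eq_sym; case: (eqVneq l.1.1 k.1.1) => [->|_]; rewrite ?subn0.
  by do 2?case: ifP => _; rewrite ?scaler0// !scalerA mulrC.
by do 2?case: ifP => _; rewrite ?scaler0// !scalerA mulrC.
Qed.

Lemma singleB n u v : single n (u - v) = single n u - single n v.
Proof.
apply/funext => i; have subE (w w' : V) n' : (w - w') n' = w n' - w' n' by [].
by rewrite subE /single; case: ifP => // _; rewrite subr0.
Qed.

Lemma singleZ n a u : single n (a *: u) = a *: single n u.
Proof.
apply/funext => i; have scaleE (w : V) n' : (a *: w) n' = a *: w n' by [].
by rewrite scaleE /single; case: ifP => // _; rewrite scaler0.
Qed.

Definition rees_ops := adjoin_family (@scaling A V) shift gens.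

(** The copy of M in multidegree 0 is Noetherian over A; the basis theorem then adjoins the shifts.
    The resulting W will be seen to contain the whole Rees module. *)
Lemma rees_noetherian : noetherian A -> finitely_generated (fullsub M) ->
  exists W : V -> Prop, [/\ forall u, W (single [ffun=> 0%N] u),
    operator_submodule rees_ops W & operator_noetherian rees_ops W].
Proof.
move=> noethA fgM; pose n0 : multidegree := [ffun=> 0%N].
pose W0 (v : V) := exists u, v = single n0 u.
have subW0 : operator_submodule (@scaling A V) W0.
  split=> [|_ _ [u ->] [v ->]|_ _ [a ->] [u ->]].
  - by exists 0; apply/funext => i; rewrite /single; case: ifP.
  - by exists (u - v); rewrite singleB.
  - by exists (a *: u); rewrite singleZ.
have noethW0 : operator_noetherian (@scaling A V) W0.
  apply: (acc_transfer (F := fun U u => U (single n0 u)) _ _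
            (noetherian_submodules noethA fgM)) => [U [subU _]|U U' [_ UW] [_ U'W] UU'].
    split=> [|u v Uu Uv|_ u [a ->] Uu].
    - have -> : single n0 0 = 0 by apply/funext => i; rewrite /single; case: ifP.
      exact: osub0 subU.
    - by rewrite singleB; apply: (osubB subU).
    - by rewrite singleZ; apply: (osub_op subU) => //; exists a.
  split=> [u|FU' v U'v]; first exact: UU'.
  by have [u e] := U'W _ U'v; rewrite e; apply: FU'; rewrite -e.
have [||||W [W0W subW noethW]] := hilbert_basis (F := shift) gens _ _ _ _ subW0 noethW0.
- by move=> _ [a ->] u v; rewrite scalerBr.
- exact: shiftB.
- by move=> k _ [a ->] u; rewrite shiftZ.
- exact: shift_comm.
by exists W; split=> // u; apply: W0W; exists u.
Qed.

Section Components.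
Variable comp : nat -> M -> M.
Hypotheses (comp_piece : forall i u, gM i (comp i u))
  (compB : forall i u v, comp i (u - v) = comp i u - comp i v)
  (comp_homogeneous : forall i mu u, gM mu u -> comp i u = if i == mu then u else 0)
  (comp_sum : forall u, exists r, u = \sum_(i < r) comp i u).

(** As h raises degrees by e, the component of h u in degree i is either 0 or h applied to the
    component of u in degree i - e. *)
Lemma comp_shift (G G' : nat -> M -> Prop) (e : nat) (h : M -> M) :
  graded_subgroup x G' -> (forall u v, h (u - v) = h u - h v) ->
  (forall mu u, gM mu u -> gM (mu + e)%N (h u)) ->
  (forall mu u, G mu u -> G' (mu + e)%N (h u)) ->
  forall u, (forall i, G i (comp i u)) -> forall i, G' i (comp i (h u)).
Proof.
move=> subG' hB gMh Gh u Gu i.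
have sumE (f : M -> M) (fB : forall u v, f (u - v) = f u - f v) r F :
    f (\sum_(i < r) F i) = \sum_(i < r) f (F i).
  by apply: (big_morph f (opD fB) (op0 fB)).
have [r ->] := comp_sum u; rewrite (sumE h)// (sumE (comp i))//.
elim/big_ind: _ => [|u1 u2|l _]; [exact: gsub0 subG' _|exact: gsubD subG' _ _ _|].
rewrite (comp_homogeneous _ (gMh _ _ (comp_piece l u))).
by case: eqP => [->|_]; [apply: Gh|apply: (gsub0 subG')].
Qed.

(** The scalars with this property form a subring containing A_0 and the x_j, hence all of A. *)
Lemma comp_scale P n : stable_family P ->
  forall a u, (forall i, P n i (comp i u)) -> forall i, P n i (comp i (a *: u)).
Proof.
move=> [subP P0 _] a.
pose S a := `[< forall u, (forall i, P n i (comp i u)) ->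
                forall i, P n i (comp i (a *: u)) >].
suff : a \in S by move/asboolP.
apply: x_gen => [|b gb|b [j _ <-]].
- split=> [|b c /asboolP Sb /asboolP Sc|b c /asboolP Sb /asboolP Sc];
    apply/asboolP => u Pu i.
  + by rewrite scale1r.
  + by rewrite scalerBl compB; apply: gsubB => //; [apply: Sb|apply: Sc].
  + by rewrite -scalerA; apply: Sb; apply: Sc.
- apply/asboolP; apply: (comp_shift (e := 0)) => //.
  + by move=> u v; rewrite scalerBr.
  + by move=> mu u gu; rewrite addnC; apply: mod_pieceZ.
  + by move=> mu u Pu; rewrite addn0; apply: P0.
- apply/asboolP; apply: (comp_shift (e := 1)) => //.
  + by move=> u v; rewrite scalerBr.
  + by move=> mu u gu; rewrite addnC; apply: mod_pieceZ.
  + by move=> mu u Pu; rewrite addn1; have [_ _] := subP n; apply.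
Qed.

(** To P corresponds the operator submodule of those v in W whose homogeneous components all lie in
    P. The elements [single n u] recover P from it, so inclusions are reflected and [acc_transfer]
    applies. *)
Lemma families_noetherian (W : V -> Prop) :
  operator_submodule rees_ops W -> operator_noetherian rees_ops W ->
  acc (fun P : multidegree * nat * M -> Prop =>
    stable_family (fun n mu u => P (n, mu, u)) /\
    forall n mu u, P (n, mu, u) -> gM mu u /\ W (single n u)).
Proof.
move=> subW noethW.
apply: (acc_transfer (F := fun (P : multidegree * nat * M -> Prop) (v : V) =>
  W v /\ forall n mu, P (n, mu, comp mu (v n))) _ _ noethW)
    => [P [stabP PW]|P P' [stabP PW] [stabP' P'W] PP'].
  have [subP _ Pk] := stabP; split=> [|v []//].
  split=> [|u v [Wu Pu] [Wv Pv]|_ v [[a ->]|[k ks ->]] [Wv Pv]].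
  - split=> [|n mu]; first exact: osub0 subW.
    have -> : (0 : V) n = 0 by [].
    by rewrite (op0 (compB mu)); exact: (gsub0 (subP n)).
  - split=> [|n mu]; first exact: osubB subW _ _ _ _.
    have -> : (u - v) n = u n - v n by [].
    by rewrite compB; apply: (gsubB (subP n)).
  - split=> [|n mu]; first by apply: (osub_op subW) => //; left; exists a.
    exact: (comp_scale stabP a (Pv n)).
  - split=> [|n]; first by apply: (osub_op subW) => //; right; exists k.
    rewrite /shift; case: ifP => [n0|_ mu]; last first.
      by rewrite (op0 (compB mu)); exact: (gsub0 (subP n)).
    apply: (comp_shift (G := fun mu u => P (decr k.1.1 n, mu, u))
      (G' := fun mu u => P (n, mu, u)) (e := k.1.2) (h := fun u => k.2 *: u)) => //.
    + by move=> u u'; rewrite scalerBr.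
    + move=> mu u gu; rewrite addnC; exact: (mod_pieceZ (gens_homogeneous ks) gu).
    + by move=> mu u Pu; rewrite -[n](decrK n0); apply: Pk.
split=> [v [Wv Pv]|FP' [[n mu] u] P'u]; first by split=> // n mu; apply: PP'.
have [gu Wu] := P'W _ _ _ P'u; have [subP' _ _] := stabP'.
have [|_ /(_ n mu)] := FP' (single n u); last first.
  by rewrite /single eqxx (comp_homogeneous _ gu) eqxx.
split=> // n' mu'; rewrite /single; case: eqP => [->|_].
  by rewrite (comp_homogeneous _ gu); case: eqP => [->|_] //; exact: (gsub0 (subP' n)).
by rewrite (op0 (compB mu')); exact: (gsub0 (subP' n')).
Qed.

End Components.

End MultigradedFamilies.

(** * Linear bounds for multigraded families *)

Section Boundedness.
Variables (A : comNzRingType) (gA : ring_grading A) (d : nat) (x : 'I_d -> A).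
Variables (M : lmodType A) (t : nat) (gens : seq (generator A t)).
Local Notation family := (family M t).
Local Notation stable_family := (stable_family gA x gens).
Implicit Types P Q : family.

Definition total_degree (n : {ffun 'I_t -> nat}) := (\sum_j n j)%N.

Lemma total_degree_incr j n : total_degree (incr j n) = (total_degree n).+1.
Proof.
rewrite /total_degree; under eq_bigr do rewrite ffunE.
rewrite big_split/= (bigD1 j)//= eqxx big1 ?addn0// => i /negPf->//.
Qed.

Variable top : family.
Hypothesis noeth_top : acc (fun P : {ffun 'I_t -> nat} * nat * M -> Prop =>
  stable_family (fun n mu u => P (n, mu, u)) /\
  forall n mu u, P (n, mu, u) -> top n mu u).
Variable K : nat.
Hypothesis gens_degree : forall k, k \in gens -> (k.1.2 <= K)%N.

Lemma killed_family_bounded P Q : stable_family P -> stable_family Q ->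
  (forall n mu u, Q n mu u -> P n mu u) ->
  (forall n mu u, P n mu u -> top n mu u) ->
  (forall j n mu u, P n mu u -> Q n mu.+1 (x j *: u)) ->
  exists B, forall n mu u,
    (K * total_degree n + B <= mu)%N -> P n mu u -> Q n mu u.
Proof.
move=> [subP P0 Pk] [subQ Q0 Qk] QP Ptop xPQ.
(* [U m] is stable: a generator of degree at most K raises |n| by one, so it preserves the region mu
   <= K |n| + m, while an x_j may leave the region but maps P into Q. *)
pose U m (p : {ffun 'I_t -> nat} * nat * M) :=
  if (p.1.2 <= K * total_degree p.1.1 + m)%N then P p.1.1 p.1.2 p.2
  else Q p.1.1 p.1.2 p.2.
have UP m p : U m p -> P p.1.1 p.1.2 p.2 by rewrite /U; case: ifP => // _ /QP.
have QU m p : Q p.1.1 p.1.2 p.2 -> U m p by rewrite /U; case: ifP => // _ /QP.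
have [m|m p|m0 Hm0] := noeth_top (U := U).
- split=> [|n mu u /UP/Ptop//]; split=> [n|n mu a u ga|n mu k u ks].
  + split=> [mu|mu u v|j mu u Uu].
    * by apply: QU; exact: gsub0 (subQ n) _.
    * rewrite /U/=; case: ifP => _; first exact: gsubB (subP n) _ _ _.
      exact: gsubB (subQ n) _ _ _.
    * by apply: QU; apply: xPQ; apply: UP Uu.
  + by rewrite /U/=; case: ifP => _; [apply: P0|apply: Q0].
  + rewrite /U/= total_degree_incr mulnS; have := gens_degree ks.
    case: (leqP mu) => [le1 le2 Pu|_ _ Qu]; last first.
      by case: ifP => _; [apply/QP/Qk|apply: Qk].
    by rewrite ifT; [exact: Pk|rewrite addnC -addnA leq_add].
- rewrite /U; case: (leqP p.1.2) => [le1|_ Qp]; last by case: ifP => // _; apply: QP.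
  by rewrite ifT//; lia.
(* In degrees above K |n| + m0 the family [U m0] is Q, whereas [U mu] is P in degree mu. *)
exists m0.+1 => n mu u lt_mu Pu.
have := Hm0 mu (n, mu, u); rewrite /U /= leq_addl leqNgt.
have -> : (K * total_degree n + m0 < mu)%N by lia.
exact.
Qed.

Lemma family_bounded P Q : stable_family P -> stable_family Q ->
  (forall n mu u, Q n mu u -> P n mu u) ->
  (forall n mu u, P n mu u -> top n mu u) ->
  exists B, forall n i mu, (K * total_degree n + B <= mu)%N ->
    koszul_vanishing x (P n) (Q n) i mu.
Proof.
(* At stage c all x_j but the last c are known to map P into Q: c = d imposes nothing, and c = 0 is
   the case of [killed_family_bounded]. *)
suff bounded c : forall P Q, stable_family P -> stable_family Q ->
    (forall n mu u, Q n mu u -> P n mu u) ->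
    (forall n mu u, P n mu u -> top n mu u) ->
    (forall j : 'I_d, (j + c < d)%N ->
       forall n mu u, P n mu u -> Q n mu.+1 (x j *: u)) ->
    exists B, forall n i mu, (K * total_degree n + B <= mu)%N ->
      koszul_vanishing x (P n) (Q n) i mu.
  by move=> stP stQ QP Ptop; apply: (bounded d) => // j; lia.
elim: c => [|c IHc] {}P {}Q stP stQ QP Ptop xPQ.
  have [|B HB] := killed_family_bounded stP stQ QP Ptop.
    by move=> j; apply: xPQ; rewrite addn0.
  have [[subP _ _] [subQ _ _]] := (stP, stQ).
  exists B => n i mu le_mu; apply: koszul_vanishing_killed => // nu u le_nu.
  by apply: HB; apply: leq_trans le_nu.
(* For c >= d there is no variable of index d - c - 1, and the condition is empty at both stages. *)
have [lt_cd|le_dc] := ltnP c d; last by apply: IHc => // j; lia.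
have lt_j0 : (d - c.+1 < d)%N by lia.
pose j0 := Ordinal lt_j0.
have [[subP _ _] [subQ _ _]] := (stP, stQ).
(* The variable of index [j0] kills both the kernel and the cokernel, and the earlier variables
   still do, so the induction hypothesis applies to each. *)
have [||||j ltj n mu u [Pu Qu]|B1 HB1] :=
    IHc (fun n => colon_piece x (P n) (Q n) j0) Q.
- exact: colon_family_stable.
- exact: stQ.
- move=> n mu u Qu; split; first exact: QP.
  by have [_ _] := subQ n; apply.
- by move=> n mu u [/Ptop].
- have [ltj'|le_j] := ltnP (j + c.+1) d; first exact: xPQ.
  by have -> : j = j0 by apply/val_inj => /=; lia.
have QQ' n mu u : Q n mu u -> sum_piece x (P n) (Q n) j0 mu u.
  move=> Qu; exists u, 0; rewrite scaler0 addr0; split=> //.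
  by case: mu Qu => // mu _; exact: gsub0 (subP n) _.
have [||||j ltj n mu u Pu|B2 HB2] :=
    IHc P (fun n => sum_piece x (P n) (Q n) j0).
- exact: stP.
- exact: sum_family_stable.
- move=> n mu _ [q [p [/QP Pq Pp ->]]]; apply: (gsubD (subP n)) => //.
  case: mu {Pq} Pp => [->|mu Pp]; first by rewrite scaler0; apply: gsub0.
  by have [_ _] := subP n; apply.
- exact: Ptop.
- have [ltj'|le_j] := ltnP (j + c.+1) d; first exact/QQ'/xPQ.
  have -> : j = j0 by apply/val_inj => /=; lia.
  by exists 0, u; split=> //; [exact: gsub0 (subQ n) _|rewrite add0r].
exists (maxn B1 B2) => n i mu le_mu.
apply: (koszul_vanishing_extension (j := j0) (subP n) (subQ n)
          (B := K * total_degree n + maxn B1 B2)) le_mu => i' mu' le'.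
  by apply: HB1; lia.
by apply: HB2; lia.
Qed.

End Boundedness.

(** * Regularity and Koszul cohomology *)

Section LocalizationFractions.
Variables (A : comNzRingType) (N : lmodType A) (f : A).

Lemma frac0 s : Defs.frac f (0 : N) s = 0.
Proof. by apply/fracP; exists 0%N; rewrite !scaler0. Qed.

Lemma fracD s (u v : N) : Defs.frac f (u + v) s = Defs.frac f u s + Defs.frac f v s.
Proof.
rewrite [RHS]loc_addE; apply/fracP; exists 0%N.
by rewrite -scalerDr scalerA -exprD.
Qed.

Lemma frac_widen r s (u : N) : Defs.frac f (f ^+ r *: u) (s + r) = Defs.frac f u s.
Proof. by apply/fracP; exists 0%N; rewrite scalerA -exprD !add0n. Qed.

Lemma frac_sign n s (u : N) :
  Defs.frac f ((-1) ^+ n *: u) s = Defs.frac f u s *~ ((-1) ^+ n).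
Proof.
rewrite -![(-1) ^+ n]signr_odd; case: (odd n); rewrite ?expr0 ?expr1 ?scale1r//.
by rewrite scaleN1r mulrN1z [RHS]loc_oppE.
Qed.

Lemma frac_eq0 s (u : N) : Defs.frac f u s = 0 -> exists e, f ^+ e *: u = 0.
Proof. by move=> /fracP[e]; rewrite scaler0 addn0; exists e. Qed.

End LocalizationFractions.

Section Regularity.
Variables (A : comNzRingType) (d : nat) (x : 'I_d -> A).
Variables (N : lmodType A) (gN : nat -> set N).
Hypothesis subN : graded_subgroup x gN.

Lemma cech_diff_frac s (m : {set 'I_d} -> N) (c : cochain x N) (T : {set 'I_d}) :
  (forall j, j \in T -> c (T :\ j) = Defs.frac (xprod x (T :\ j)) (m (T :\ j)) s) ->
  cech_diff c T = Defs.frac (xprod x T) (koszul_diff x s m T) s.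
Proof.
move=> Hc; rewrite /koszul_diff.
rewrite (big_morph (Defs.frac (xprod x T) ^~ s) (@fracD _ _ _ s) (@frac0 _ _ _ s)).
apply: eq_bigr => j jT; rewrite Hc// (@loc_mapE _ _ _ _ (xprod x T)); last first.
  by rewrite mulrC /xprod (big_setD1 j).
by rewrite -frac_sign scalerA.
Qed.

(** The cocycle is written with common denominators. The Koszul differential of its numerators may
    vanish only after multiplication by powers of the [xprod T], so one passes to a later Koszul
    complex, and the boundary found there gives a Cech coboundary. *)
Lemma cech_coboundary i (mu : nat) (c : cochain x N) :
  koszul_vanishing x gN (fun _ u => u = 0) i mu ->
  cocycles gN i mu%:Z c -> coboundaries gN i mu%:Z c.
Proof.
move=> van [cech_c dc].
have /choice[mk Hmk] (S : {set 'I_d}) : exists mk : N * nat,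
    c S = Defs.frac (xprod x S) mk.1 mk.2 /\
    (#|S| = i -> gN (mu + mk.2 * i)%N mk.1).
  have := cech_c S; case: eqP => [_ [m [k [gm ->]]]|neq ->]; first by exists (m, k).
  by exists (0, 0%N); split=> [|/neq//]; rewrite frac0.
pose s := (\max_S (mk S).2)%N.
pose m1 S := xprod x S ^+ (s - (mk S).2) *: (mk S).1.
have le_s S : ((mk S).2 <= s)%N by apply: leq_bigmax.
have cm1 S : c S = Defs.frac (xprod x S) (m1 S) s.
  by rewrite -[X in Defs.frac _ _ X](subnKC (le_s S)) frac_widen; have [] := Hmk S.
have gm1 (S : {set 'I_d}) : #|S| = i -> gN (mu + s * i)%N (m1 S).
  move=> cardS; have [_ /(_ cardS) gm] := Hmk S.
  apply: (gsub_xprod subN gm).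
  by rewrite cardS -addnA -mulnDl subnKC.
have /choice[e He] (T : {set 'I_d}) : exists e,
    xprod x T ^+ e *: koszul_diff x s m1 T = 0.
  by apply: (@frac_eq0 _ _ _ s); rewrite -(cech_diff_frac (c := c)).
pose e0 := (\max_T e T)%N.
have le_e T : (e T <= e0)%N by apply: leq_bigmax.
have [|r [b [gb Hb]]] := van (s + e0)%N (fun S => xprod x S ^+ e0 *: m1 S).
  split=> [S cardS|T cardT].
    by apply: (gsub_xprod subN (gm1 _ cardS)); rewrite cardS; lia.
  by rewrite koszul_diff_xprod -(subnK (le_e T)) exprD -scalerA He scaler0.
(* Cech cochains vanish on sets of the wrong cardinality, where nothing is known about [b]. *)
pose b1 (S : {set 'I_d}) := if #|S|.+1 == i then b S else 0.
exists (fun S => Defs.frac (xprod x S) (b1 S) (s + e0 + r)); split.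
  rewrite /b1; case: (i) gb => [_ S|j gb S]; first by rewrite frac0.
  rewrite eqSS; case: eqP => [cardS|_]; last by rewrite frac0.
  exists (b S), (s + e0 + r)%N; split=> //.
  by have := gb S; rewrite cardS; apply.
move=> S; rewrite (@cech_diff_frac (s + e0 + r) b1)//.
have cardD j : j \in S -> #|S| = #|S :\ j|.+1 by rewrite [#|S|](cardsD1 j) => ->.
have [cardS|neqS] := eqVneq #|S| i.
  rewrite (@eq_koszul_diff _ _ _ _ _ _ b); last first.
    by move=> j jS; rewrite /b1 -cardD// cardS eqxx.
  move/eqP: (Hb S cardS); rewrite subr_eq0 => /eqP <-.
  by rewrite frac_widen frac_widen.
rewrite (@eq_koszul_diff _ _ _ _ _ _ (fun=> 0)); last first.
  by move=> j jS; rewrite /b1 -cardD// (negPf neqS).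
rewrite [koszul_diff _ _ _ _]big1 ?frac0; last by move=> j _; rewrite scaler0.
by have := cech_c S; rewrite (negPf neqS).
Qed.

Lemma supremum_le (S : set (\bar int)) b :
  (forall y, S y -> y <= b)%E -> (supremum -oo S <= b)%E.
Proof.
move=> leb; rewrite /supremum; case: ifP => _; first exact: leNye.
(* If there is no supremum, the value is the default -oo, which satisfies the bound as well. *)
by case: xgetP => [z _ [_ lbz]|_]; [apply: lbz => y /leb|exact: leNye].
Qed.

(** A nonzero class has i <= d, since no set of indices is larger, and degree below B. *)
Lemma reg_le B :
  (forall i mu, (B <= mu)%N -> koszul_vanishing x gN (fun _ u => u = 0) i mu) ->
  (reg x gN <= (B + d)%N%:Z%:E)%E.
Proof.
move=> van.
suff bound i mu : local_cohomology_neq0 x gN i mu -> mu + i%:Z <= (B + d)%N%:Z.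
  apply: supremum_le => _ [i _ <-].
  have : (a_inv x gN i <= ((B + d)%N%:Z - i%:Z)%:E)%E.
    by apply: supremum_le => _ [mu /bound le_mu <-]; rewrite lee_fin; lia.
  by case: (a_inv x gN i) => [r| |] //; rewrite !lee_fin; lia.
move=> [c cocyc ncob]; rewrite leNgt; apply/negP => lt_mu; apply: ncob.
have [le_id|lt_di] := leqP i d.
  have [mu' e] : exists mu' : nat, mu = mu'%:Z by exists `|mu|%N; lia.
  rewrite e in cocyc lt_mu *; apply: cech_coboundary => //; apply: van; lia.
have c0 S : c S = 0.
  case: cocyc => /(_ S) + _; rewrite ltn_eqF//.
  by apply: leq_ltn_trans lt_di; rewrite -[d in (_ <= d)%N]card_ord max_card.
exists (fun S => Defs.frac (xprod x S) 0 0); split=> [|S].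
  case: i {cocyc lt_mu} lt_di => [//|j] _ S; case: ifP => _; last by rewrite frac0.
  exists 0, 0%N; split=> //; rewrite /int_piece mul0n addr0.
  by case: mu => //= mu; exact: gsub0 subN _.
rewrite (@cech_diff_frac 0 (fun=> 0))// c0.
by rewrite [koszul_diff _ _ _ _]big1 ?frac0 => // j _; rewrite scaler0.
Qed.

End Regularity.

(** Passes from predicates on M, used for the families, to the type of the submodule, on which [reg]
    is taken. *)
Lemma koszul_vanishing_submodule (A : comNzRingType) (d : nat) (x : 'I_d -> A)
    (M : lmodType A) (gM : nat -> set M) (N : submodClosed M) i mu :
  koszul_vanishing x (fun mu u => gM mu u /\ u \in N) (fun _ u => u = 0) i mu ->
  koszul_vanishing x (induced_piece gM (N := N)) (fun _ u => u = 0) i mu.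
Proof.
move=> van s m [gm dm].
have val_diff s' m' T :
    val (koszul_diff x s' m' T) = koszul_diff x s' (fun S => val (m' S)) T
    :> M.
  rewrite /koszul_diff raddf_sum; apply: eq_bigr => j _.
  exact: linearZ.
have [|r [b [gb Hb]]] := van s (fun S => val (m S)).
  split=> [S cardS|T cardT]; first by split; [exact: gm|exact: valP].
  by rewrite -val_diff dm.
(* The default 0 is taken where [b S] lies outside N, which does not happen for the cardinality that
   matters. *)
pose b' S : submodule_type N := insubd 0 (b S).
have valb' (S : {set 'I_d}) : #|S|.+1 = i -> val (b' S) = b S.
  by move=> cardS; apply: insubdK; have [_ +] := gb S cardS.
exists r, b'; split=> [S cardS|T cardT].
  by rewrite /induced_piece /= valb'//; have [] := gb S cardS.
apply: val_inj; rewrite raddfB/= val_diff.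
rewrite (@eq_koszul_diff _ _ _ _ _ _ b) => [|j jT]; first by rewrite -[RHS](Hb T cardT).
by apply: valb'; rewrite -cardT (cardsD1 j T) jT.
Qed.

Lemma induced_piece_subgroup (A : comNzRingType) (d : nat) (x : 'I_d -> A)
    (M : lmodType A) (gM : nat -> set M) (N : submodClosed M) :
  graded_subgroup x gM -> graded_subgroup x (induced_piece gM (N := N)).
Proof.
move=> subM; split=> [mu|mu u v gu gv|j mu u gu].
- by have := gsub0 subM mu.
- by have := gsubB subM gu gv; rewrite -raddfB.
- by have [_ _ /(_ j _ _ gu)] := subM; rewrite -linearZ.
Qed.

(** * Products of powers of ideals *)

Section Products.
Variables (A : comNzRingType) (M : lmodType A).

Lemma mem_smul (I : ideal A) (N : submodClosed M) a u :
  a \in I -> u \in N -> a *: u \in smul I N.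
Proof. by move=> Ia Nu; apply: mem_span; exists a, u. Qed.

Lemma smul_sub (I : ideal A) (N : submodClosed M) (U : M -> Prop) :
  operator_submodule (@scaling A M) U ->
  (forall a u, a \in I -> u \in N -> U (a *: u)) ->
  forall v, v \in smul I N -> U v.
Proof. by move=> subU IU; apply: span_sub => // _ [a [u [Ia Nu ->]]]; apply: IU. Qed.

End Products.

Section MultiplicationIntoPowers.
Variables (A : comNzRingType) (t : nat) (I : 'I_t -> ideal A).

Local Notation power_product r n :=
  (\big[@smul A A^o/fullsub A^o]_(j <- r) ideal_pow (I j) (n j)).

Lemma preimage_submodule (M : lmodType A) (N : submodClosed M) (a : A) :
  operator_submodule (@scaling A M) (fun u => a *: u \in N).
Proof.
apply: scaling_submodule => [|b u v Nu Nv]; first by rewrite scaler0 rpred0.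
by rewrite scalerDr rpredD// scalerA mulrC -scalerA rpredZ.
Qed.

(** Induction on r: the factor of index j occurs exactly once, absorbs a, and is reached by
    commuting a past the other factors. *)
Lemma mul_power_product (r : seq 'I_t) (n n' : 'I_t -> nat) j a :
  uniq r -> j \in r -> n' j = (n j).+1 -> (forall i, i != j -> n' i = n i) ->
  a \in I j -> forall b, b \in power_product r n -> a *: b \in power_product r n'.
Proof.
move=> + + n'j n'i Ia; elim: r => [//|i r IHr] /= /andP[inr uniq_r].
rewrite inE !big_cons; case: (eqVneq i j) => [eij _|neq /= jr].
  have -> : power_product r n' = power_product r n.
    rewrite [LHS]big_seq [RHS]big_seq; apply: eq_bigr => l lr.
    by rewrite n'i//; apply: contraNneq inr; rewrite eij => <-.
  apply: smul_sub => [|b c Ib Pc]; first exact: preimage_submodule.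
  rewrite scalerA eij n'j; apply: mem_smul => //.
  by apply: (@mem_smul A A^o); rewrite // -eij.
rewrite n'i//; apply: smul_sub => [|b c Ib Pc]; first exact: preimage_submodule.
by rewrite scalerA mulrC -scalerA; apply: mem_smul => //; apply: IHr.
Qed.

Variables (M : lmodType A) (X : {ffun 'I_t -> nat} -> M -> Prop).
Hypothesis subX : forall n, operator_submodule (@scaling A M) (X n).

(** J acts on the family X with multidegree e. The target n' is given pointwise, so that e may be
    any function. *)
Definition raises (J : ideal A) (e : 'I_t -> nat) := forall a, a \in J ->
  forall (n n' : {ffun 'I_t -> nat}) u,
    (forall i, n' i = n i + e i)%N -> X n u -> X n' (a *: u).

Lemma raising_submodule e : operator_submodule (@scaling A A^o)
  (fun a : A => forall (n n' : {ffun 'I_t -> nat}) u,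
    (forall i, n' i = n i + e i)%N -> X n u -> X n' (a *: u)).
Proof.
apply: scaling_submodule => [n n' u _ _|b c c' Xc Xc' n n' u e_n Xu].
  by rewrite scale0r; exact: osub0 (subX n').
rewrite scalerDl -scalerA; apply: (osubD (subX n')); last exact: Xc' e_n Xu.
by apply: (osub_op (subX n')); [exists b|exact: Xc e_n Xu].
Qed.

Lemma raises_smul J J' e e' : raises J e -> raises J' e' ->
  raises (smul J J') (fun i => e i + e' i)%N.
Proof.
move=> XJ XJ'; apply: smul_sub => [|a b Ja J'b n n' u en Xu].
  exact: raising_submodule.
rewrite -scalerA; apply: (XJ _ Ja [ffun i => n i + e' i]%N).
  by move=> i; rewrite ffunE en; lia.
by apply: XJ' Xu => // i; rewrite ffunE.
Qed.

Lemma raises_fullsub : raises (fullsub A^o) (fun=> 0%N).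
Proof.
move=> a _ n n' u en Xu; have -> : n' = n by apply/ffunP => i; rewrite en addn0.
by apply: (osub_op (subX n)) => //; exists a.
Qed.

Hypothesis raiseI : forall j, raises (I j) (fun i => (i == j) : nat).

(** Multidegrees add along products, and the factor I_j^(n_j) contributes n_j in position j only.
    This will place I^n M inside the Rees operator module. *)
Lemma raises_power_product n :
  raises (\big[@smul A A^o/fullsub A^o]_(j < t) ideal_pow (I j) (n j)) n.
Proof.
have raise_pow j k : raises (ideal_pow (I j) k) (fun i => (i == j) * k)%N.
  elim: k => [|k IHk].
    have -> : (fun i => (i == j) * 0)%N = (fun=> 0%N) by apply/funext => i; rewrite muln0.
    exact: raises_fullsub.
  have -> : (fun i => (i == j) * k.+1)%N = (fun i => (i == j) + (i == j) * k)%N.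
    by apply/funext => i; rewrite mulnS.
  exact: raises_smul.
have raise_prod r : raises (power_product r n) (fun i => \sum_(j <- r) (i == j) * n j)%N.
  elim: r => [|j r IHr].
    rewrite big_nil (_ : (fun i => _) = fun=> 0%N); first exact: raises_fullsub.
    by apply/funext => i; rewrite big_nil.
  rewrite big_cons; have := raises_smul (raise_pow j (n j)) IHr.
  by congr (raises _ _); apply/funext => i; rewrite big_cons.
have := raise_prod (index_enum 'I_t); congr (raises _ _).
apply/funext => i; rewrite (bigD1 i)//= eqxx mul1n big1 ?addn0// => j /negPf.
by rewrite eq_sym => ->.
Qed.

End MultiplicationIntoPowers.

(** Each of finitely many generators is a combination of finitely many homogeneous elements of I;
    these together generate I. *)
Lemma homogeneous_generators (A : comNzRingType) (gA : ring_grading A) (I : ideal A) :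
  noetherian A -> homogeneous_ideal gA I ->
  exists s : seq (nat * A),
    (forall p, p \in s -> gA p.1 p.2 /\ p.2 \in I) /\
    (forall U : A^o -> Prop, operator_submodule (@scaling A A^o) U ->
       (forall p, p \in s -> U p.2) -> forall a, a \in I -> U a).
Proof.
move=> noethA [G [Ghom GI]]; have [s Hs] := noethA I.
suff: exists s' : seq (nat * A),
    (forall p, p \in s' -> gA p.1 p.2 /\ p.2 \in I) /\
    (forall U : A^o -> Prop, operator_submodule (@scaling A A^o) U ->
       (forall p, p \in s' -> U p.2) -> forall a, a \in s -> U a).
  move=> [s' [s'I s'U]]; exists s'; split=> // U subU Us' a.
  rewrite Hs; apply: (span_sub subU) => b bs; exact: s'U subU Us' _ bs.
have: {subset s <= I} by move=> a as'; rewrite Hs; apply: mem_span.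
elim: s {Hs} => [_|a s IHs sI]; first by exists [::].
have [|s' [s'I s'U]] := IHs; first by move=> b bs; apply: sI; rewrite inE bs orbT.
have := sI a (mem_head a s); rewrite GI => /asboolP[n [c [g [Gg ->]]]].
have /choice[e He] i := Ghom _ (Gg i).
exists ([seq (e i, g i : A) | i <- enum 'I_n] ++ s'); split=> [p|U subU Us' b].
  rewrite mem_cat => /orP[/mapP[i _ ->]|/s'I//].
  by split; [exact: He|rewrite GI; exact: mem_span (Gg i)].
rewrite inE => /predU1P[->|]; last first.
  by apply: s'U => // p ps; apply: Us'; rewrite mem_cat ps orbT.
apply: (osub_sum subU) => i _; apply: (osub_op subU); first by exists (c i).
apply: (Us' (e i, g i : A)); rewrite mem_cat; apply/orP; left.
by apply: map_f; rewrite mem_enum.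
Qed.

(** * The linear bound on the regularity *)

Unset Implicit Arguments.
Set Strict Implicit.

Theorem corollary4p4 (A : comNzRingType) (gA : ring_grading A)
  (A_noetherian : noetherian A)
  (A_standard : standard_grading gA)
  (A0_artinian : artinian (deg0 gA))
  (A0_local : local_ring (deg0 gA))
  (d : nat) (x : 'I_d -> A)
  (x_deg1 : forall i, gA 1%N (x i))
  (x_gen : generates_over_deg0 gA (range x))
  (t : nat) (t_gt0 : (0 < t)%N)
  (I : 'I_t -> ideal A) (I_homogeneous : forall j, homogeneous_ideal gA (I j))
  (M : lmodType A) (gM : mod_grading gA M)
  (M_fg : finitely_generated (fullsub M)) :
  exists k k' : int, forall n : 'I_t -> nat,
    let N := smul (\big[@smul A A^o/fullsub A^o]_(j < t) ideal_pow (I j) (n j))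
                  (fullsub M) in
    (reg x (induced_piece gM (N := N))
       <= ((\sum_(j < t) n j)%N%:Z * k + k')%:E)%E.
Proof.
have /choice[s Hs] j := homogeneous_generators A_noetherian (I_homogeneous j).
pose gens : seq (generator A t) := [seq (j, p.1, p.2) | j <- enum 'I_t, p <- s j].
have gensP k : k \in gens -> gA k.1.2 k.2 /\ k.2 \in I k.1.1.
  by move=> /allpairsPdep[j [p [_ ps ->]]]; exact: (Hs j).1.
have mem_gens j p : p \in s j -> (j, p.1, p.2) \in gens.
  by move=> ps; apply/allpairsPdep; exists j, p; rewrite mem_enum.
pose K := (\max_(k <- gens) k.1.2)%N.
have gens_degree k : k \in gens -> (k.1.2 <= K)%N by move=> ks; apply: leq_bigmax_seq.
pose N (n : {ffun 'I_t -> nat}) : submodClosed M :=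
  smul (\big[@smul A A^o/fullsub A^o]_(j < t) ideal_pow (I j) (n j)) (fullsub M).
have [gMsub _ _] := mod_piece_direct gM.
have gM0 mu : gM mu 0 := (gMsub mu).1.
have gMB mu u v : gM mu u -> gM mu v -> gM mu (u - v) by apply: (gMsub mu).2.
have gMx j mu u : gM mu u -> gM mu.+1 (x j *: u).
  by move=> gu; rewrite -add1n; apply: mod_pieceZ.
have gens_homogeneous k (ks : k \in gens) := (gensP k ks).1.
have [comp [comp_piece compB comp_hom comp_sum]] :=
  homogeneous_components (mod_piece_direct gM).
have [W [W0 subW noethW]] := rees_noetherian gens A_noetherian M_fg.
have noeth_top := families_noetherian x_deg1 x_gen gens_homogeneous
  comp_piece compB comp_hom comp_sum subW noethW.
pose P n mu u := gM mu u /\ u \in N n.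
pose Q (n : {ffun 'I_t -> nat}) (mu : nat) (u : M) := u = 0.
have stabP : stable_family gA x gens P.
  split=> [n|n mu a u ga [gu Nu]|n mu k u ks [gu Nu]].
  - split=> [mu|mu u v [gu Nu] [gv Nv]|j mu u [gu Nu]].
    + by split; rewrite ?rpred0.
    + by split; [apply: gMB|rewrite rpredB].
    + by split; [apply: gMx|rewrite rpredZ].
  - by split; [exact: (mod_pieceZ ga gu)|rewrite rpredZ].
  - have [gk Ik] := gensP k ks; split; first by rewrite addnC; exact: (mod_pieceZ gk gu).
    move: u Nu {gu}; apply: smul_sub => [|a u Ja Mu]; first exact: preimage_submodule.
    rewrite scalerA; apply: mem_smul => //.
    apply: (mul_power_product (j := k.1.1) (n := n) _ _ _ _ Ik) => //.
    + exact: index_enum_uniq.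
    + exact: mem_index_enum.
    + by rewrite ffunE eqxx.
    + by move=> i /negPf neq; rewrite ffunE neq.
have stabQ : stable_family gA x gens Q.
  split=> [n|n mu a _ _ ->|n mu k _ _ ->]; rewrite /Q ?scaler0//.
  by split=> [//|mu u v -> ->|j mu u ->]; rewrite ?subr0 ?scaler0.
have subX n : operator_submodule (@scaling A M) (fun u => W (single n u)).
  split=> [|u v Wu Wv|_ u [a ->] Wu].
  - have -> : single n (0 : M) = 0 by apply/funext => i; rewrite /single; case: ifP.
    exact: osub0 subW.
  - by rewrite singleB; apply: (osubB subW).
  - by rewrite singleZ; apply: (osub_op subW) => //; left; exists a.
(* By linearity it suffices to treat the generators of I_j, which act through [shift]. *)
have raiseI j : raises (fun n u => W (single n u)) (I j) (fun i => (i == j) : nat).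
  apply: (Hs j).2 => [|p ps n n' u en Wu]; first exact: raising_submodule.
  have -> : n' = incr j n by apply/ffunP => i; rewrite en ffunE addnC.
  rewrite -(shift_single (j, p.1, p.2)); apply: (osub_op subW) => //; right.
  by exists (j, p.1, p.2) => //; apply: mem_gens.
(* Elements of I^n M are reached from the copy of M in multidegree 0, contained in W by [W0]. *)
have Ptop n mu u : P n mu u -> gM mu u /\ W (single n u).
  move=> [gu Nu]; split=> //; move: u Nu {gu}.
  apply: smul_sub => [|a u Ja _]; first exact: subX.
  apply: (raises_power_product subX raiseI Ja) (W0 u) => i.
  by rewrite ffunE.
have QP n mu u : Q n mu u -> P n mu u by move=> ->; split; rewrite ?rpred0.
have [B HB] := family_bounded noeth_top gens_degree stabP stabQ QP Ptop.
(* The slope is the bound on the degrees of the generators; d bounds the cohomological index, as in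
   [reg_le]. *)
exists K%:Z, (B + d)%N%:Z => n0.
(* The families are indexed by finite functions, the statement by plain ones. *)
have -> : n0 = ([ffun j => n0 j] : {ffun 'I_t -> nat}) :> (_ -> _).
  by apply/funext => j; rewrite ffunE.
move: [ffun j => n0 j] => n {n0} /=.
have -> : (\sum_(j < t) n j)%N%:Z * K%:Z + (B + d)%N%:Z =
          (K * total_degree n + B + d)%N%:Z.
  by rewrite !PoszD PoszM mulrC addrA.
apply: reg_le => [|i mu le_mu]; first exact: induced_piece_subgroup.
by apply: koszul_vanishing_submodule; apply: HB.
Qed.
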